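(* Let $C>0$ be a given constant, let $0<\varepsilon_g<1/2$, and let $0<a_1<a_2$ be constants. Let $\xi_1,\dots,\xi_n$ be i.i.d. copies of a subgaussian random variable with mean zero and variance one. Assume $a_1N\le x\le a_2N$ and $x\le\sqrt n-N^{\varepsilon_g}$. Then for $\delta=N^{-C}$ and any open ball $B(a,\delta)\subset\mathbb R^2$, \[\mathbb P\Big(\tfrac1{\sqrt N}S_n(x,\xi)\in B(a,\delta)\Big)=O(\delta^2),\qquad S_n(x,\xi)=\sum_{i=1}^n\xi_i\big(b_i(x),c_i(x)\big).\]
   Context: $N$ is a large parameter with $N\le\sqrt n$ (in the paper $N=M$, the scale of the interval $[c_1M,c_2M]\subset[0,\sqrt n-M]$). For $x>0$, $b_i(x)=\sqrt N e^{-x^2/2}x^i/\sqrt{i!}$ and $c_i(x)=b_i'(x)=\sqrt N e^{-x^2/2}\frac{i-x^2}{x}\frac{x^i}{\sqrt{i!}}$; thus $S_n(x,\xi)/\sqrt N=(P_n(x),P_n'(x))$ with $P_n(x)=e^{-x^2/2}\sum_{i=1}^n\xi_ix^i/\sqrt{i!}$. Implied constants may depend on $C,\varepsilon_g,a_1,a_2$ and the law of $\xi$. *)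

(* Defs.v *)
From HB Require Import structures.
From mathcomp Require Import all_boot all_order all_algebra.
From mathcomp Require Import all_classical all_reals all_analysis.
Set Implicit Arguments. Unset Strict Implicit. Unset Printing Implicit Defensive.
Import Order.TTheory GRing.Theory Num.Theory.
Import numFieldNormedType.Exports.
Local Open Scope classical_set_scope.
Local Open Scope ring_scope.

Section Defs.
Context {R : realType} {d : measure_display} {T : measurableType d}.
Variable P : probability T R.

Definition mutually_independent (xi : nat -> {RV P >-> R}) : Prop :=
  forall (s : seq nat) (B : nat -> set R), uniq s ->
    (forall i, measurable (B i)) ->
    P (\bigcap_(i in [set j | j \in s]) (xi i @^-1` B i)) =
    (\prod_(i <- s) P (xi i @^-1` B i))%E.

Definition identically_distributed (xi : nat -> {RV P >-> R}) : Prop :=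
  forall (i : nat) (B : set R), measurable B ->
    P (xi i @^-1` B) = P (xi 0%N @^-1` B).

Definition iid (xi : nat -> {RV P >-> R}) : Prop :=
  mutually_independent xi /\ identically_distributed xi.

Definition subgaussian (X : {RV P >-> R}) : Prop :=
  exists c : R, 0 < c /\ forall t : R, 0 <= t ->
    (P [set w | (t <= `|X w|)%R] <= (2 * expR (- (t ^+ 2) / (c ^+ 2)))%:E)%E.
End Defs.

Definition bcoef {R : realType} (N : R) (i : nat) (x : R) : R :=
  Num.sqrt N * expR (- (x ^+ 2) / 2) * x ^+ i / Num.sqrt (i`!)%:R.

(* c_i(x) = b_i'(x) = sqrt N e^{-x^2/2} (i - x^2)/x * x^i / sqrt(i!) *)
Definition ccoef {R : realType} (N : R) (i : nat) (x : R) : R :=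
  Num.sqrt N * expR (- (x ^+ 2) / 2) * ((i%:R - x ^+ 2) / x) * x ^+ i
  / Num.sqrt (i`!)%:R.

Definition Sn {R : realType} {d : measure_display} {T : measurableType d}
  {P : probability T R} (xi : nat -> {RV P >-> R}) (N : R) (n : nat) (x : R)
  (w : T) : R * R :=
  (\sum_(1 <= i < n.+1) xi i w * bcoef N i x,
   \sum_(1 <= i < n.+1) xi i w * ccoef N i x).

Definition ball2 {R : realType} (a : R * R) (r : R) : set (R * R) :=
  [set u | (u.1 - a.1) ^+ 2 + (u.2 - a.2) ^+ 2 < r ^+ 2].

(* Main.v *)
(** Write [q i] for the square root of the Poisson([x ^ 2]) mass at [i], so that
    [(P_n x, P_n' x) = \sum_i xi_i q_i (1, (i - x^2)/x)].

    Fourier side. If [|U|, |V| < del] and [2 M del <= 1], then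
    [1 <= 4/M^4 |\sum_(k in [0,M)^2) exp (i (k1 U + k2 V))|^2]; taking expectations bounds
    the small ball probability by [4/M^4 \sum_(k,l) |phi (k - l)|], where [phi] is the
    characteristic function of the random vector at integer frequencies. By independence
    [|phi t|^2 = \prod_i E cos (f_i zeta)], where [f_i = q_i (t1 + t2 (i - x^2)/x)] and
    [zeta = xi_0 - xi_1]. As [zeta] lies in some [[z1, z2]], [z1 > 0], with positive
    probability, it suffices that [\sum_i (1 - cos (z f_i)) >= c min ((z |t|)^2, x)] for
    [|t|] at most a fixed power of [x]: the sum over [k, l] is then
    [O(M^2) + M^4 exp (- c x)].

    Lower bound for the phase sum. To the left of the mode, for [i = x^2 - s x] with [s]
    in a suitable bounded interval, the [j]-th difference of [f] with step [h] has constant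
    sign and size of order [|t| x^(-1/2) (h/x)^j]. For [j] large, [h >= 1] can be chosen so
    that this is at most [1] and still at least of order [min (|t| x^(-1/2), 1)]. Since
    [|sin (./2)|] is even and subadditive, this lower bound passes from the differences to
    the values of [f], on average over about [x] indices. *)
Require Import Defs.
From HB Require Import structures.
From mathcomp Require Import all_boot all_order all_algebra.
From mathcomp Require Import ring lra.
From mathcomp Require Import all_classical all_reals all_analysis.
From mathcomp Require Import measurable_realfun.
Set Implicit Arguments. Unset Strict Implicit. Unset Printing Implicit Defensive.
Import Order.TTheory GRing.Theory Num.Theory.
Import numFieldNormedType.Exports.
Local Open Scope classical_set_scope.
Local Open Scope ring_scope.

(** * Finite differences *)

Section Differences.
Context {R : realFieldType}.
Implicit Types (u v q : nat -> R) (h i j k m : nat).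

Definition fdiff h u i : R := u (i + h)%N - u i.

Local Notation Dl := (fdiff 1).

Lemma iter_fdiff1S k u i :
  iter k.+1 Dl u i = iter k Dl u i.+1 - iter k Dl u i.
Proof. by rewrite iterS /fdiff addn1. Qed.

Lemma leibniz_fdiff k u v i :
  iter k Dl (fun i => u i * v i) i =
  \sum_(m < k.+1) 'C(k, m)%:R * (iter m Dl u i * iter (k - m) Dl v (i + m)%N).
Proof.
elim: k i => [|k IH] i; first by rewrite big_ord1 bin0 mul1r addn0.
rewrite iter_fdiff1S !IH -sumrB.
pose t m := iter m Dl u i * iter (k.+1 - m) Dl v (i + m)%N.
transitivity (\sum_(m < k.+1) 'C(k, m)%:R * (t m.+1 + t m)).
  apply: eq_bigr => -[m /= mk] _; rewrite -mulrBr; congr (_ * _).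
  rewrite /t subSS iter_fdiff1S subSn// iter_fdiff1S addSnnS addnS; ring.
under eq_bigr => m _ do rewrite mulrDr.
rewrite big_split/= [X in _ + X]big_ord_recl/= [RHS]big_ord_recl/= !bin0 !mul1r.
under [in RHS]eq_bigr => m _ do
  rewrite /bump/= add1n binS natrD mulrDl -/(t m.+1).
rewrite big_split/= [X in _ = _ + (X + _)]big_ord_recr/= bin_small// mul0r addr0.
rewrite -/(t 0%N); under [X in _ + (_ + X) = _]eq_bigr => m _ do
  rewrite /bump/= add1n.
ring.
Qed.

(** Second differences of the affine factor vanish, so only two terms of the Leibniz rule
    survive. *)
Lemma affine_leibniz k (L : nat -> R) (s : R) q i :
  (forall i, L i.+1 - L i = s) ->
  iter k.+1 Dl (fun i => L i * q i) i =
  L i * iter k.+1 Dl q i + k.+1%:R * s * iter k Dl q i.+1.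
Proof.
move=> Ls; have LS l : L l.+1 = L l + s by rewrite -(Ls l) addrC subrK.
elim: k i => [|k IH] i; first by rewrite /= /fdiff !addn1 LS; ring.
rewrite iter_fdiff1S !IH LS (iter_fdiff1S k.+1 q i) (iter_fdiff1S k q i.+1).
rewrite -[k.+2%:R]natr1; ring.
Qed.

(** Here [r i = x^2 / (i+1)]. Applying [affine_leibniz] to the constant product [(i+1) * r i] gives
    [(i+1) D^(m+1) r i = - (m+1) D^m r (i+1)], and [1 / (i+1) <= 2 / x^2] on the window, so each
    difference costs a factor [2 (m+1) / x^2]. *)
Lemma inv_fdiff_bound m (x : R) (r : nat -> R) a b : 0 < x ->
  (forall i, (a <= i <= b)%N -> x ^+ 2 <= 2 * i.+1%:R) ->
  (forall i, i.+1%:R * r i = x ^+ 2) ->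
  forall i, (a <= i)%N -> (i + m <= b)%N ->
    `|iter m Dl r i| <= 2 * m`!%:R * (2 * x ^- 2) ^+ m.
Proof.
move=> x0 hx hr; have x20 : 0 < x ^+ 2 by rewrite exprn_gt0.
have bnd i : (a <= i <= b)%N -> 0 < i.+1%:R^-1 * x^+2 <= 2.
  move=> /hx h; rewrite mulr_gt0 ?invr_gt0 ?ltr0n//=.
  by rewrite mulrC ler_pdivrMr ?ltr0n.
elim: m => [|m IH] i ai ib.
  rewrite /= expr0 fact0 !mulr1.
  have /bnd : (a <= i <= b)%N by rewrite ai /= -(addn0 i).
  have -> : i.+1%:R^-1 * x ^+ 2 = r i by rewrite -(hr i) mulKf// pnatr_eq0.
  by case/andP=> h1 h2; rewrite gtr0_norm.
have iab : (a <= i <= b)%N by rewrite ai (leq_trans _ ib)// leq_addr.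
have H : i.+1%:R * iter m.+1 Dl r i = - (m.+1%:R * iter m Dl r i.+1).
  have := @affine_leibniz m (fun i => i.+1%:R) 1 r i _.
  rewrite (_ : (fun i0 => i0.+1%:R * r i0) = (fun=> x^+2)); last first.
    by apply: funext => l; rewrite hr.
  have -> : iter m.+1 Dl (fun=> x ^+ 2) i = 0.
    rewrite iterSr (_ : Dl _ = fun=> 0); last by apply: funext => l; rewrite /fdiff subrr.
    by elim: m {IH ib} i {ai iab} => [//|m IH] i; rewrite iter_fdiff1S !IH subrr.
  move=> E; have {E} : 0 = i.+1%:R * iter m.+1 Dl r i + m.+1%:R * 1 * iter m Dl r i.+1.
    by apply: E => l; rewrite -natr1 addrAC subrr add0r.
  by rewrite mulr1 => /eqP; rewrite eq_sym addr_eq0 => /eqP.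
have -> : iter m.+1 Dl r i = - (i.+1%:R^-1 * m.+1%:R * iter m Dl r i.+1).
  by rewrite -mulrA -mulrN -H mulKf// pnatr_eq0.
rewrite normrN !normrM normfV !normr_nat.
have := IH i.+1 (leq_trans ai (leqnSn _)); rewrite addSnnS => /(_ ib) {}IH.
apply: le_trans (ler_wpM2l _ IH) _; first by rewrite mulr_ge0 ?invr_ge0.
have -> : 2 * m.+1`!%:R * (2 * x ^- 2) ^+ m.+1 =
  (2 * x^-2) * m.+1%:R * (2 * m`!%:R * (2 * x^-2)^+m).
  by rewrite factS natrM exprS; ring.
have p0 : 0 <= x^-2 by rewrite invr_ge0 ltW.
rewrite ler_wpM2r ?mulr_ge0 ?exprn_ge0 ?mulr_ge0// ler_wpM2r//.
by rewrite ler_pdivlMr//; case/andP: (bnd _ iab).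
Qed.

Lemma sum_binom k (c : R) : \sum_(m < k.+1) 'C(k, m)%:R * c = 2 ^+ k * c.
Proof.
rewrite -mulr_suml; congr (_ * _).
rewrite -[2]/(1 + 1 : R) exprDn; apply: eq_bigr => i _.
by rewrite !expr1n mulr1.
Qed.

(* Since rho^2 = x^2/(i+1) has explicit differences, the Leibniz rule for rho * rho is
   solved for the top-order difference of rho. *)
Lemma sqrt_ratio_fdiff_bound j : exists K : R, 1 <= K /\
  forall (x : R) (rho : nat -> R) a b, 0 < x ->
  (forall i, (a <= i <= b)%N -> x ^+ 2 <= 2 * i.+1%:R) ->
  (forall i, (a <= i <= b)%N -> 1 <= rho i <= 2) ->
  (forall i, i.+1%:R * (rho i ^+ 2) = x ^+ 2) ->
  forall m i, (m <= j)%N -> (a <= i)%N -> (i + m <= b)%N ->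
    `|iter m Dl rho i| <= K * (x ^- 2) ^+ m.
Proof.
elim: j => [|j [K [K1 IH]]].
  exists 2; split; first lra.
  move=> x rho a b x0 h1 h2 h3 m i; rewrite leqn0 => /eqP -> ai; rewrite addn0 => ib.
  have /h2 /andP[] : (a <= i <= b)%N by rewrite ai.
  by rewrite /= expr0 => *; rewrite ger0_norm; lra.
pose K' := K + (2 * j.+1`!%:R * 2 ^+ j.+1 + 2 ^+ j.+1 * (K * K)).
have KK : K <= K'.
  by rewrite lerDl addr_ge0// !mulr_ge0 ?exprn_ge0//; lra.
exists K'; split; first lra.
move=> x rho a b x0 h1 h2 h3 m i; rewrite leq_eqVlt ltnS => /orP[/eqP -> | mj] ai ib; last first.
  apply: le_trans (IH x rho a b x0 h1 h2 h3 m i mj ai ib) _.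
  by rewrite ler_wpM2r// exprn_ge0// invr_ge0 exprn_ge0 ?ltW.
have y0 : 0 <= x^-2 by rewrite invr_ge0 exprn_ge0 ?ltW.
set y := x^-2 in y0 *.
have := @inv_fdiff_bound j.+1 x (fun i => rho i * rho i) a b x0 h1 _ i ai ib.
move=> /(_ (fun i => esym (eq_trans (esym (h3 i)) _))) A.
have {A} : `|iter j.+1 Dl (fun i : nat => rho i * rho i) i| <= 2 * (j.+1)`!%:R * (2 * y) ^+ j.+1.
  by apply: A; move=> *; rewrite expr2.
rewrite leibniz_fdiff big_ord_recl big_ord_recr/= /bump leq0n add1n bin0 binn subnn addn0 !mul1r /=.
set S := \sum_(_ < _) _.
rewrite -[Dl (iter (0 + j) Dl rho) i]/(iter j.+1 Dl rho i).
set D := iter j.+1 Dl rho i.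
have SK : `|S| <= 2 ^+ j.+1 * (K * K) * y ^+ j.+1.
  apply: le_trans (ler_norm_sum _ _ _) _.
  apply: le_trans (_ : \sum_(l < j) 'C(j.+1, 1 + l)%:R * ((K * K) * y ^+ j.+1) <= _).
    apply: ler_sum => -[l /= lj] _; rewrite normrM normr_nat ler_wpM2l//.
    rewrite normrM.
    have lj1 : (l.+1 <= j)%N by [].
    have e1 := IH x rho a b x0 h1 h2 h3 l.+1 i lj1 ai _.
    have e2 := IH x rho a b x0 h1 h2 h3 (j.+1 - l.+1)%N (i + l.+1)%N _ _ _.
    apply: le_trans (ler_pM _ _ (e1 _) (e2 _ _ _)) _ => //.
    - by rewrite (leq_trans _ ib)// leq_add2l leqW.
    - by rewrite subSS leq_subr.
    - by rewrite (leq_trans ai)// leq_addr.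
    - by rewrite -addnA subnKC// ltnS ltnW.
    have -> : y ^+ j.+1 = y ^+ l.+1 * y ^+ (j.+1 - l.+1) by rewrite -exprD subnKC// ltnS ltnW.
    by rewrite -/y le_eqVlt; apply/orP; left; apply/eqP; ring.
  rewrite -(mulrA (2 ^+ _)) -sum_binom big_ord_recl big_ord_recr/= .
  have ? : 0 <= K * K * y ^+ j.+1 by rewrite !mulr_ge0 ?exprn_ge0//; lra.
  rewrite [X in _ <= _ + X]addrC addrA lerDr addr_ge0// mulr_ge0//.
have /h2 /andP[r1 _] : (a <= i <= b)%N by rewrite ai (leq_trans _ ib)// leq_addr.
have /h2 /andP[r2 _] : (a <= i + j.+1 <= b)%N by rewrite ib (leq_trans ai)// leq_addr.
move=> T.
(* The two extreme Leibniz terms both contain [D], with total coefficient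
   [rho i + rho (i + j.+1) >= 2]; the inner terms, collected in [S], only involve orders at most
   [j]. *)
have : `|(rho i + rho (i + j.+1)%N) * D| <= `|rho i * D + (S + D * rho (i + j.+1)%N)| + `|S|.
  by rewrite (_ : (_ + _) * D = (rho i * D + (S + D * rho (i + j.+1)%N)) - S) ?ler_normB//; ring.
rewrite normrM ger0_norm; last lra.
move=> U.
have D0 := normr_ge0 D.
rewrite /K' mulrDl.
have : 0 <= K * y ^+ j.+1 by rewrite mulr_ge0 ?exprn_ge0//; lra.
rewrite exprMn in T. rewrite mulrDl.
have : `|D| <= (rho i + rho (i + j.+1)%N) * `|D| by nra.
rewrite mulrA in T.
lra.
Qed.

(** While [2 m t <= 1], the compound growth [(1 + t)^m] stays below [1 + 2 m t], since each step
    adds at most [t (1 + 2 m t) <= 2 t]. *)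
Lemma slow_growth (t : R) (q eps : nat -> R) a b : 0 <= t ->
  (forall i, q i.+1 = (1 + eps i) * q i) ->
  (forall i, (a <= i <= b)%N -> 0 < q i) ->
  (forall i, (a <= i <= b)%N -> eps i <= t) ->
  forall m i, 2 * m%:R * t <= 1 -> (a <= i)%N -> (i + m <= b)%N ->
  q (i + m)%N <= (1 + 2 * m%:R * t) * q i.
Proof.
move=> t0 qE q0 et; elim=> [|m IH] i mt ai ib.
  by rewrite addn0 mulr0 mul0r addr0 mul1r.
have mt' : 2 * m%:R * t <= 1.
  by apply: le_trans mt; rewrite ler_wpM2r// ler_wpM2l// ler_nat.
have ib' : (i + m <= b)%N by rewrite (leq_trans _ ib)// addnS.
have := IH i mt' ai ib'; rewrite addnS qE.
have imab : (a <= i + m <= b)%N by rewrite ib' (leq_trans ai)// leq_addr.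
have := et _ imab; have := q0 _ imab.
have : 0 < q i by apply: q0; rewrite ai (leq_trans _ ib')// leq_addr.
move: (q i) (q (i + m)%N) (eps _) => Q Q' e Q0 Q'0 h1 h2.
have m0 : 0 <= m%:R * t by rewrite mulr_ge0.
apply: (@le_trans _ _ ((1 + t) * Q')); first by rewrite ler_wpM2r ?(ltW Q'0)//; lra.
apply: (@le_trans _ _ ((1 + t) * ((1 + 2 * m%:R * t) * Q))).
  by rewrite ler_wpM2l//; lra.
rewrite mulrA ler_wpM2r ?(ltW Q0)//.
rewrite -[m.+1%:R]natr1; set c := m%:R in m0 mt' *.
have : (2 * c * t) * t <= 1 * t by rewrite ler_wpM2r.
lra.
Qed.

(** Put [z = B y]. Since the first difference of [q] is [eps * q] with [eps] of order [z], each
    difference should multiply [q] by about [z]. In the Leibniz expansion the term with [eps]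
    undifferenced is the main one. A term with [m >= 1] differences on [eps] has size
    [y^(2m) z^(k-m) = z^(k+m) / B^(2m)], at most [z^(k+1) / B^2] up to constants, which is
    negligible once [B] is large. *)
Lemma fdiff_log_slope_bound j (K : R) : 1 <= K -> exists B0 : R, 1 <= B0 /\
  forall (B y : R) (q eps : nat -> R) a b, B0 <= B -> 0 < y ->
  10 * j%:R * (B * y) <= 1 -> B * y <= 1 ->
  (forall i, q i.+1 = (1 + eps i) * q i) ->
  (forall i, (a <= i <= b)%N -> 0 < q i) ->
  (forall i, (a <= i <= b)%N -> B * y / 2 <= eps i <= 5 * (B * y)) ->
  (forall m i, (0 < m <= j)%N -> (a <= i)%N -> (i + m <= b)%N ->
    `|iter m Dl eps i| <= K * (y ^+ 2) ^+ m) ->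
  forall k i, (k <= j)%N -> (a <= i)%N -> (i + k <= b)%N ->
  (B * y / 4) ^+ k * q i <= iter k Dl q i <= (10 * (B * y)) ^+ k * q i.
Proof.
(* The error terms sum to at most [2 K 20^k z^(k+1) / B^2] times [q i], where [20] is [2] from the
   binomials times [10] from the upper bound. This must be below [(z/4)^(k+1) q i], that is
   [8 K 80^k <= B^2]. *)
move=> K1; exists (8 * K * 80 ^+ j).
have p1 : 1 <= (80:R) ^+ j by rewrite exprn_ege1//; lra.
split; first by nra.
move=> B y q eps a b hB y0 hj hz qE q0 he hD.
have B1 : 1 <= B by nra.
set z := B * y in hj hz he *.
have z0 : 0 < z by rewrite mulr_gt0//; lra.
have growth m i : (m <= j)%N -> (a <= i)%N -> (i + m <= b)%N -> q (i + m)%N <= 2 * q i.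
  move=> mj ai ib.
  have hh : 2 * m%:R * (5 * z) <= 1.
    apply: le_trans hj; rewrite [leLHS](_ : _ = 10 * m%:R * z); last by ring.
    by rewrite ler_wpM2r ?(ltW z0)// ler_wpM2l// ler_nat.
  have := @slow_growth (5 * z) q eps a b _ qE q0 _ m i hh ai ib.
  have qi0 : 0 < q i by apply: q0; rewrite ai (leq_trans _ ib)// leq_addr.
  move=> H; apply: le_trans (H _ _) _; first by nra.
    by move=> l /he /andP[].
  by rewrite ler_wpM2r ?(ltW qi0)//; lra.
elim/ltn_ind => -[|k] IH i kj ai ib; first by rewrite !expr0 !mul1r lexx.
have qi0 : 0 < q i by apply: q0; rewrite ai (leq_trans _ ib)// leq_addr.
have iab : (a <= i <= b)%N by rewrite ai (leq_trans _ ib)// leq_addr.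
have ik : (i + k <= b)%N by rewrite (leq_trans _ ib)// leq_add2l.
rewrite iterSr (_ : Dl q = fun i => eps i * q i); last first.
  by apply: funext => l; rewrite /fdiff addn1 qE; ring.
rewrite leibniz_fdiff big_ord_recl bin0 mul1r addn0 subn0 [iter (nat_of_ord ord0) _ _ _]/=.
set S := \sum_(_ < _) _.
have SB : `|S| <= (z / 4) ^+ k.+1 * q i.
  pose c := 2 * K * 10 ^+ k * z ^+ k.+1 / B ^+ 2 * q i.
  have c0 : 0 <= c.
    by rewrite /c !mulr_ge0 ?invr_ge0 ?exprn_ge0 ?(ltW z0) ?(ltW qi0)//; lra.
  have : `|S| <= 2 ^+ k * c.
    apply: le_trans (ler_norm_sum _ _ _) _.
    rewrite -sum_binom big_ord_recl ler_wpDl//; first exact: mulr_ge0.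
    apply: ler_sum => -[l /= lk] _; rewrite normrM normr_nat ler_wpM2l//.
    rewrite normrM /bump leq0n add1n.
    have lk1 : (l.+1 <= k)%N by [].
    have il : (i + l.+1 <= b)%N by rewrite (leq_trans _ ik)// leq_add2l.
    have lj : (l.+1 <= j)%N by rewrite (leq_trans lk1)// ltnW.
    have e1 := hD l.+1 i lj ai il.
    have ail : (a <= i + l.+1)%N by rewrite (leq_trans ai)// leq_addr.
    have kl : (k - l.+1 <= j)%N by rewrite (leq_trans (leq_subr _ _))// ltnW.
    have ikl : (i + l.+1 + (k - l.+1) <= b)%N by rewrite -addnA subnKC.
    have kk : (k - l.+1 < k.+1)%N by rewrite ltnS leq_subr.
    have /andP[e2 e3] := IH _ kk (i + l.+1)%N kl ail ikl.
    have e4 := growth _ _ lj ai il.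
    have z10 : 0 <= (10 * z) ^+ (k - l.+1) by rewrite exprn_ge0//; nra.
    have q0' : 0 < q (i + l.+1)%N by apply: q0; rewrite ail.
    have e5 : `|iter (k - l.+1) Dl q (i + l.+1)%N| <= (10 * z) ^+ (k - l.+1) * (2 * q i).
      rewrite ger0_norm; last first.
        by apply: le_trans e2; rewrite mulr_ge0 ?(ltW q0')// exprn_ge0//; nra.
      by apply: le_trans e3 _; rewrite ler_wpM2l.
    apply: le_trans (ler_pM _ _ e1 e5) _ => //.
    rewrite /c [leLHS](_ : _ =
      (2 * K * ((y ^+ 2) ^+ l.+1 * (10 * z) ^+ (k - l.+1))) * q i); last by ring.
    rewrite ler_wpM2r ?(ltW qi0)// -!mulrA ler_wpM2l// ler_wpM2l ?(le_trans _ K1)//.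
    have Bn0 : B != 0 by rewrite gt_eqF//; lra.
    have -> : y = z / B by rewrite /z mulrAC mulfV// mul1r.
    rewrite -exprM [(10 * z) ^+ _]exprMn.
    have -> : (z / B) ^+ (2 * l.+1) * (10 ^+ (k - l.+1) * z ^+ (k - l.+1)) =
      10 ^+ (k - l.+1) * (z ^+ (l.+1 + k) * B^-1 ^+ (2 * l.+1)).
      have -> : z ^+ (l.+1 + k) = z ^+ (2 * l.+1) * z ^+ (k - l.+1).
        by rewrite -exprD; congr (_ ^+ _); rewrite mul2n -addnn -addnA subnKC.
      by rewrite exprMn; ring.
    apply: ler_pM; rewrite ?exprn_ge0 ?mulr_ge0 ?exprn_ge0 ?invr_ge0 ?(ltW z0)//;
      try lra.
      by apply: ler_weXn2l; [lra|rewrite leq_subr].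
    apply: ler_pM; rewrite ?exprn_ge0 ?mulr_ge0 ?exprn_ge0 ?invr_ge0 ?(ltW z0)//;
      try lra.
      by apply: ler_wiXn2l; rewrite ?(ltW z0)// addSn ltnS leq_addl.
    rewrite -exprVn; apply: ler_wiXn2l; rewrite ?invr_ge0; try lra.
      by rewrite invf_le1//; lra.
    by rewrite leq_pmulr.
  move=> H; apply: le_trans H _; rewrite /c.
  have B20 : 0 < B ^+ 2 by rewrite exprn_gt0//; lra.
  rewrite [leLHS](_ : _ = (2 * K * 20 ^+ k / B ^+ 2) * z ^+ k.+1 * q i); last first.
    by rewrite (_ : 20 = 2 * 10 :> R) ?exprMn; [ring|ring].
  rewrite ler_wpM2r ?(ltW qi0)// [(z / 4) ^+ _]exprMn [leLHS]mulrC ler_wpM2l ?exprn_ge0 ?(ltW z0)//.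
  rewrite ler_pdivrMr// exprVn -ler_pdivrMl ?invr_gt0 ?exprn_gt0// invrK.
  have : (80:R) ^+ k <= 80 ^+ j by apply: ler_weXn2l; [lra | exact: ltnW].
  rewrite (_ : 80 = 4 * 20 :> R) ?exprMn; last by ring.
  have h20 : 0 <= (20:R) ^+ k by rewrite exprn_ge0.
  have h4 : 0 <= (4:R) ^+ k by rewrite exprn_ge0.
  rewrite exprS => h8.
  have : 8 * K * (4 ^+ k * 20 ^+ k) <= B.
    by apply: le_trans hB; rewrite (_ : 80 = 4 * 20 :> R) ?exprMn; [rewrite ler_wpM2l//; nra|ring].
  move=> h9; have : B <= B ^+ 2 by rewrite expr2 ler_peMl//; lra.
  lra.
have /andP[g1 g2] := IH k (ltnSn k) i (ltnW kj) ai ik.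
have /andP[f1 f2] := he i iab.
have z4 : 0 <= (z / 4) ^+ k by rewrite exprn_ge0//; lra.
have z10 : 0 <= (10 * z) ^+ k by rewrite exprn_ge0//; lra.
have zz : (z / 4) ^+ k <= (10 * z) ^+ k by rewrite lerXn2r ?nnegrE//; clear - z0; lra.
have A0 : 0 <= (z / 4) ^+ k * q i by rewrite mulr_ge0 ?(ltW qi0).
have A1 : z / 2 * ((z / 4) ^+ k * q i) <= eps i * iter k Dl q i.
  by apply: ler_pM => //; lra.
have A2 : eps i * iter k Dl q i <= 5 * z * ((10 * z) ^+ k * q i).
  by apply: ler_pM => //; lra.
have zzq : (z / 4) ^+ k * q i <= (10 * z) ^+ k * q i by rewrite ler_wpM2r ?(ltW qi0).
move: SB; rewrite ler_norml => /andP[S1 S2].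
rewrite exprS -mulrA in S1 S2; rewrite !exprS -[_ * _ * q i]mulrA -[10 * z * _ * q i]mulrA.
have A3 : z / 4 * ((z / 4) ^+ k * q i) <= 5 * z * ((10 * z) ^+ k * q i).
  by apply: ler_pM => //; lra.
clear - S1 S2 A1 A2 A3; clearbody S z.
move: (_ * q i) (_ * q i) (_ * iter k Dl q i) S1 S2 A1 A2 A3 => u w v *.
by apply/andP; split; lra.
Qed.

(** By [affine_leibniz] the main term is [L] times the top difference of [q]. The correction
    contains [s] times a difference of one order less; as [|s| <= 2 y L / B] and [y = z / B] with
    [z = B y], it is smaller by a factor of order [B^-2]. *)
Lemma affine_fdiff_bound j (K : R) : 1 <= K -> exists B0 : R, 1 <= B0 /\
  forall (B y s : R) (q eps L : nat -> R) a b, B0 <= B -> 0 < y ->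
  10 * j.+1%:R * (B * y) <= 1 -> B * y <= 1 ->
  (forall i, q i.+1 = (1 + eps i) * q i) ->
  (forall i, (a <= i <= b)%N -> 0 < q i) ->
  (forall i, (a <= i <= b)%N -> B * y / 2 <= eps i <= 5 * (B * y)) ->
  (forall m i, (0 < m <= j.+1)%N -> (a <= i)%N -> (i + m <= b)%N ->
    `|iter m Dl eps i| <= K * (y ^+ 2) ^+ m) ->
  (forall i, L i.+1 - L i = s) ->
  (forall i, (a <= i <= b)%N -> 0 < L i /\ B * `|s| <= 2 * y * L i) ->
  forall i, (a <= i)%N -> (i + j.+1 <= b)%N ->
  2^-1 * L i * ((B * y / 4) ^+ j.+1 * q i) <= iter j.+1 Dl (fun i => L i * q i) i
    <= 2 * L i * ((10 * (B * y)) ^+ j.+1 * q i).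
Proof.
move=> K1; have [B0 [B01 H]] := fdiff_log_slope_bound j.+1 K1.
exists (B0 + 32 * j.+1%:R * 40 ^+ j).
have cj : 0 <= 32 * j.+1%:R * 40 ^+ j :> R by rewrite !mulr_ge0 ?exprn_ge0.
split; first by lra.
move=> B y s q eps L a b hB y0 hj hz qE q0 he hD Ls L0 i ai ib.
have hB0 : B0 <= B by lra.
have {}H := H B y q eps a b hB0 y0 hj hz qE q0 he hD.
have iab : (a <= i <= b)%N by rewrite ai (leq_trans _ ib)// leq_addr.
have ib1 : (i.+1 + j <= b)%N by rewrite addSnnS.
have /andP[e1 e2] := H j.+1 i (leqnn _) ai ib.
have /andP[e3 e4] := H j i.+1 (leqnSn _) (leqW ai) ib1.
rewrite (affine_leibniz _ _ _ Ls).
have [Li sL] := L0 i iab.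
have qi0 := q0 _ iab.
have iab1 : (a <= i.+1 <= b)%N by rewrite (leqW ai) (leq_trans _ ib1)// leq_addr.
have qi1 := q0 _ iab1.
set z := B * y in hj hz he e1 e2 e3 e4 *.
have B1 : 1 <= B by lra.
have z0 : 0 < z by rewrite mulr_gt0//; lra.
have zj : 0 <= (z / 4) ^+ j by rewrite exprn_ge0//; lra.
have z10 : 0 <= (10 * z) ^+ j by rewrite exprn_ge0//; lra.
have qq : q i.+1 <= 2 * q i.
  rewrite qE ler_wpM2r ?(ltW qi0)//; have /andP[_] := he i iab.
  have : 1 <= j.+1%:R :> R by rewrite ler1n.
  nra.
set D := iter j Dl q i.+1 in e3 e4 *.
have D0 : 0 <= D by apply: le_trans e3; rewrite mulr_ge0 ?(ltW qi1).
have X : `|j.+1%:R * s * D| <= 2^-1 * L i * ((z / 4) ^+ j.+1 * q i).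
  rewrite !normrM normr_nat (ger0_norm D0).
  have DD : D <= (10 * z) ^+ j * (2 * q i).
    by apply: le_trans e4 _; rewrite ler_wpM2l.
  have Bp : 0 < B by lra.
  have ss : `|s| <= 2 * y * L i / B by rewrite ler_pdivlMr// mulrC.
  rewrite -mulrA.
  apply: le_trans (ler_wpM2l _ (ler_pM _ _ ss DD)) _ => //.
  rewrite (_ : y = z / B); last by rewrite /z mulrAC mulfV ?mul1r// gt_eqF.
  rewrite (_ : j.+1%:R * _ = L i * (q i * (z ^+ j.+1 * (4 * j.+1%:R * 10 ^+ j / B ^+ 2)))); last first.
    by rewrite exprMn exprS; field; rewrite gt_eqF.
  rewrite (_ : 2^-1 * _ * _ = L i * (q i * (z ^+ j.+1 * (2^-1 * 4^-1 ^+ j.+1)))); last first.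
    by rewrite exprMn; ring.
  rewrite !ler_wpM2l ?exprn_ge0 ?(ltW Li) ?(ltW qi0) ?(ltW z0)//.
  rewrite ler_pdivrMr ?exprn_gt0// exprVn -ler_pdivrMl ?mulr_gt0 ?invr_gt0 ?exprn_gt0//.
  rewrite invfM !invrK.
  have : B <= B ^+ 2 by rewrite expr2 ler_peMl//; lra.
  suff : 2 * 4 ^+ j.+1 * (4 * j.+1%:R * 10 ^+ j) = 32 * j.+1%:R * 40 ^+ j :> R by lra.
  by rewrite (_ : 40 = 4 * 10 :> R) ?exprMn ?exprS; ring.
move: X; rewrite ler_norml => /andP[X1 X2].
have zz : (z / 4) ^+ j.+1 * q i <= (10 * z) ^+ j.+1 * q i.
  by rewrite ler_wpM2r ?(ltW qi0)// lerXn2r ?nnegrE//; lra.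
have : L i * ((z / 4) ^+ j.+1 * q i) <= L i * iter j.+1 Dl q i by rewrite ler_wpM2l// ltW.
have : L i * iter j.+1 Dl q i <= L i * ((10 * z) ^+ j.+1 * q i) by rewrite ler_wpM2l// ltW.
have : L i * ((z / 4) ^+ j.+1 * q i) <= L i * ((10 * z) ^+ j.+1 * q i) by rewrite ler_wpM2l// ltW.
rewrite -!(mulrA _ (L i)); move=> *; apply/andP; split; lra.
Qed.

Lemma iter_fdiff_sum j h u i :
  iter j Dl (fdiff h u) i = \sum_(r < h) iter j.+1 Dl u (i + r)%N.
Proof.
have -> : iter j Dl (fdiff h u) i = iter j Dl u (i + h)%N - iter j Dl u i.
  elim: j i => [//|j IH] i; rewrite !iter_fdiff1S !IH !addSn; ring.
elim: h => [|h IH]; first by rewrite big_ord0 addn0 subrr.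
by rewrite big_ord_recr -IH /= addnS -/(iter j.+1 Dl u (i + h)) iter_fdiff1S; ring.
Qed.

(** One application of [fdiff h] is a sum of [h] shifted unit differences, so each of the [j]
    applications multiplies both bounds by [h]. *)
Lemma step_fdiff_bound (m M : R) j h u a b :
  (forall i, (a <= i <= b)%N -> m <= iter j Dl u i <= M) ->
  forall i, (a <= i)%N -> (i + j * h <= b)%N ->
  h%:R ^+ j * m <= iter j (fdiff h) u i <= h%:R ^+ j * M.
Proof.
elim: j m M u b => [|j IH] m M u b H i ai ib.
  by rewrite !expr0 !mul1r H// ai -(addn0 i) -(mul0n h).
have ib' : (i + j * h <= b - h)%N.
  by rewrite mulSn addnCA in ib; rewrite leq_subRL// (leq_trans _ ib)// leq_addr.
rewrite iterSr !exprS ![h%:R * _]mulrC -!mulrA.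
apply: (IH (h%:R * m) (h%:R * M) _ (b - h)%N) => // l /andP[al lb].
rewrite iter_fdiff_sum; apply/andP; split.
  rewrite -[h in h%:R]card_ord mulr_natl -sumr_const; apply: ler_sum => r _.
  have /H/andP[]// : (a <= l + r <= b)%N.
  rewrite (leq_trans al) ?leq_addr//=.
  rewrite mulSn addnCA in ib.
  have hb : (h <= b)%N by rewrite (leq_trans _ ib)// leq_addr.
  by rewrite -(subnK hb) leq_add// ltnW.
rewrite -[h in h%:R]card_ord mulr_natl -sumr_const; apply: ler_sum => r _.
have /H/andP[]// : (a <= l + r <= b)%N.
rewrite (leq_trans al) ?leq_addr//=.
rewrite mulSn addnCA in ib.
have hb : (h <= b)%N by rewrite (leq_trans _ ib)// leq_addr.
by rewrite -(subnK hb) leq_add// ltnW.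
Qed.

End Differences.

(** * The phase sum *)

Section Trigo.
Context {R : realType}.

Lemma ler_norm_sin (v : R) : `|sin v| <= `|v|.
Proof.
wlog v0 : v / 0 <= v.
  move=> H; have [/H//|/ltW v0] := leP 0 v.
  by rewrite -normrN -sinN -[leRHS]normrN H// oppr_ge0.
have [c _] := @MVT_segment R sin cos 0 v v0 (fun x _ => is_derive_sin x)
  (continuous_subspaceT (@continuous_sin R)).
rewrite sin0 !subr0 => ->; rewrite normrM ler_piMl// ler_norml cos_geN1 cos_le1//.
Qed.

Lemma cos_sin_half (u : R) : 1 - cos u = 2 * sin (u / 2) ^+ 2.
Proof.
rewrite [in cos _](_ : u = (u / 2) *+ 2); last by rewrite -mulr_natr; field.
by rewrite cos_mulr2n cos2sin2 -mulr_natr; ring.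
Qed.

Lemma cos_ge_half (u : R) : `|u| <= 1 -> 2^-1 <= cos u.
Proof.
move=> u1; have := cos_sin_half u; have := ler_norm_sin (u / 2).
rewrite normrM (ger0_norm (_ : 0 <= 2^-1)) ?invr_ge0// => h.
have : sin (u / 2) ^+ 2 <= 2^-1 ^+ 2.
  by rewrite -real_normK ?num_real// lerXn2r ?nnegrE//; lra.
lra.
Qed.

Lemma sin_ge_half (u : R) : 0 <= u <= 1 -> u / 2 <= sin u.
Proof.
case/andP=> u0 u1.
have [c] := @MVT_segment R sin cos 0 u u0 (fun x _ => is_derive_sin x)
  (continuous_subspaceT (@continuous_sin R)).
rewrite in_itv/= sin0 !subr0 => /andP[c0 c1] ->.
have := @cos_ge_half c; rewrite ger0_norm// => /(_ (le_trans c1 u1)) h.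
by rewrite mulrC ler_wpM2r.
Qed.

(** Squared form of the subadditivity of [|sin|]; it lets a lower bound on differences be passed
    back to the original sequence. *)
Lemma sqr_sinB (x y : R) : sin (x - y) ^+ 2 <= 2 * sin x ^+ 2 + 2 * sin y ^+ 2.
Proof.
rewrite sinB; have := sqr_ge0 (sin x * cos y + cos x * sin y).
have h1 : sin x ^+ 2 * cos y ^+ 2 <= sin x ^+ 2.
  by rewrite ler_piMr ?sqr_ge0// cos2sin2 gerBl sqr_ge0.
have h2 : cos x ^+ 2 * sin y ^+ 2 <= sin y ^+ 2.
  by rewrite ler_piMl ?sqr_ge0// cos2sin2 gerBl sqr_ge0.
by rewrite !expr2 in h1 h2 *; lra.
Qed.

(** By [sqr_sinB], removing one difference replaces the sum by two sums with weight [2], both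
    contained in the window lengthened by [h]. Hence a factor [4] and [h] more indices per
    difference. *)
Lemma sum_sin_fdiff j h (u : nat -> R) a b :
  \sum_(a <= i < b) sin (iter j (fdiff h) u i / 2) ^+ 2 <=
  4 ^+ j * \sum_(a <= i < b + j * h) sin (u i / 2) ^+ 2.
Proof.
elim: j b => [|j IH] b; first by rewrite mul0n addn0 expr0 mul1r.
have [ab|/ltnW ba] := leqP a b; last first.
  rewrite (big_geq ba) mulr_ge0 ?exprn_ge0 ?sumr_ge0// => i _; exact: sqr_ge0.
set v := iter j (fdiff h) u.
apply: (@le_trans _ _ (\sum_(a <= i < b)
   (2 * sin (v (i + h)%N / 2) ^+ 2 + 2 * sin (v i / 2) ^+ 2))).
  apply: ler_sum => i _; rewrite iterS /fdiff -/v mulrBl; exact: sqr_sinB.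
rewrite big_split/= -!mulr_sumr.
have s0 c e : 0 <= \sum_(c <= i < e) sin (v i / 2) ^+ 2.
  by rewrite sumr_ge0// => i _; exact: sqr_ge0.
have e1 : \sum_(a <= i < b) sin (v (i + h)%N / 2) ^+ 2 <=
          \sum_(a <= i < b + h) sin (v i / 2) ^+ 2.
  rewrite [leRHS](@big_cat_nat _ _ _ (a + h)%N)/= ?leq_addr ?leq_add2r//.
  rewrite [X in _ <= _ + X](_ : _ = \sum_(a <= i < b) sin (v (i + h)%N / 2) ^+ 2) ?lerDr//.
  by rewrite big_addn addnK.
have e2 : \sum_(a <= i < b) sin (v i / 2) ^+ 2 <=
          \sum_(a <= i < b + h) sin (v i / 2) ^+ 2.
  by rewrite [leRHS](@big_cat_nat _ _ _ b)/= ?leq_addr// lerDl.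
have := IH (b + h)%N; rewrite -/v mulSn addnA exprS.
lra.
Qed.

(** The hypothesis [h^j M <= 1] keeps the step-[h] difference [t] in [[0, 1]], where no wrap-around
    modulo [2 pi] occurs and [sin (t/2) >= t/4]. [sum_sin_fdiff] then transfers the bound to [u]. *)
Lemma sum_cos_fdiff_ge (m M : R) j h (u : nat -> R) a l :
  0 <= m -> h%:R ^+ j * M <= 1 -> (2 * (j * h) <= l)%N ->
  (forall i, (a <= i <= a + l)%N -> m <= iter j (fdiff 1) u i <= M) ->
  4^-1 ^+ j * l%:R * (h%:R ^+ j * m) ^+ 2 / 16 <=
  \sum_(a <= i < a + l) (1 - cos (u i)).
Proof.
move=> m0 hM hl H.
have jl : (j * h <= l)%N by rewrite (leq_trans _ hl)// leq_pmull.
have st := step_fdiff_bound (h := h) H.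
under eq_bigr => i _ do rewrite cos_sin_half.
rewrite -mulr_sumr.
have := sum_sin_fdiff j h u a (a + l - j * h)%N.
rewrite subnK; last by rewrite (leq_trans jl)// leq_addl.
set S := \sum_(a <= i < a + l) _.
set w := h%:R ^+ j * m in st *.
have w0 : 0 <= w by rewrite mulr_ge0 ?exprn_ge0.
have : \sum_(a <= i < a + l - j * h) (w / 4) ^+ 2 <=
   \sum_(a <= i < a + l - j * h) sin (iter j (fdiff h) u i / 2) ^+ 2.
  rewrite big_nat_cond [leRHS]big_nat_cond; apply: ler_sum => i.
  rewrite andbT => /andP[ai il].
  have : (i + j * h <= a + l)%N by move: il; rewrite ltn_subRL addnC => /ltnW.
  move=> /(st i ai) /andP[s1 s2].
  set t := iter _ _ _ _ in s1 s2 *.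
  have t1 : t <= 1 by exact: le_trans s2 hM.
  have t0 : 0 <= t by exact: le_trans w0 s1.
  clearbody t w.
  have T : t / 2 / 2 <= sin (t / 2) by apply: sin_ge_half; apply/andP; split; lra.
  have q1 : w / 4 <= sin (t / 2) by apply: le_trans T; lra.
  have q0 : 0 <= w / 4 by lra.
  by rewrite lerXn2r ?nnegrE// (le_trans q0 q1).
rewrite sumr_const_nat -addnBA// addKn -[X in X <= _]mulr_natl.
move=> h1 h2.
(* Differencing uses up [j h] indices; at least half of the window remains. *)
have h3 : l%:R / 2 <= (l - j * h)%:R :> R.
  rewrite ler_pdivrMr// -natrM ler_nat mulnBl (mulnC (j * h)%N) muln2 -addnn.
  by rewrite -addnBA// leq_addr.
have h4 : l%:R / 2 * (w / 4) ^+ 2 <= 4 ^+ j * S.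
  by apply: le_trans (le_trans h1 h2); rewrite ler_wpM2r ?sqr_ge0.
move: h4 {st w0 h1 h2}; move: w S => w S h4.
rewrite exprVn -!mulrA ler_pdivrMl ?exprn_gt0//; move: (4 ^+ j) h4 => F; lra.
Qed.

End Trigo.

(** * A Stirling lower bound *)

Section Stirling.
Context {R : realType}.

(** The gap [f] vanishes at [0] and has derivative [1 - (1 - 2t) e^(2t) >= 0], because
    [1 - 2t <= e^(-2t)]. *)
Lemma expR2_le (z : R) : 0 <= z -> (1 - z) * expR (2 * z) <= 1 + z.
Proof.
move=> z0.
pose f (t : R) : R := (1 + t) - (1 - t) * expR (2 * t).
pose df (t : R) : R := 1 - expR (2 * t) * (1 - 2 * t).
have fd (t : R) : is_derive t (1 : R) f (df t).
  rewrite /f; apply: is_derive_eq.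
  by rewrite /df !add0r /GRing.scale/=; ring.
have fc : continuous f.
  by move=> t; apply: differentiable_continuous; apply/derivable1_diffP; case: (fd t).
have [c] := @MVT_segment R f df 0 z z0 (fun x _ => fd x) (continuous_subspaceT fc).
rewrite in_itv/= => /andP[c0 _].
rewrite {2}/f mulr0 expR0 !subr0 mulr1 !addr0 subrr subr0 => E.
rewrite -subr_ge0 -/(f z) E mulr_ge0// /df subr_ge0.
have := expR_ge1Dx (- (2 * c)); rewrite expRN => h.
by rewrite mulrC -ler_pdivlMr ?expR_gt0// mul1r.
Qed.

(** The right-hand side equals [e^(-2)] at [m = 1] and is nondecreasing: the ratio of consecutive
    values is [((k+1)/k)^(2k+1) / e^2], which is at least [1]. *)
Lemma stirling_lower (m : nat) : (0 < m)%N ->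
  expR (- 2) <= m%:R * (expR (- m%:R) * m%:R ^+ m / m`!%:R) ^+ 2 :> R.
Proof.
elim: m => [//|[_ _|m IH _]].
  by rewrite (_ : 1`! = 1%N)// expr1 divr1 mulr1 mul1r -expRM_natl mulrN1.
apply: le_trans (IH isT) _.
set k := m.+1; have k0 : 0 < k%:R :> R by rewrite ltr0n.
have kn0 : k%:R != 0 :> R by rewrite gt_eqF.
set F := k`!%:R : R; have F0 : F != 0 by rewrite pnatr_eq0 -lt0n fact_gt0.
have k1 : k.+1%:R = k%:R + 1 :> R by rewrite -natr1.
clearbody k.
rewrite (_ : k.+1%:R * _ = (k%:R * (expR (- k%:R) * k%:R ^+ k / F) ^+ 2) *
   (((k%:R + 1) / k%:R) ^+ (2 * k).+1 / expR 2)); last first.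
  rewrite factS natrM -/F k1 opprD expRD [(k%:R + 1) ^+ k.+1]exprS.
  have -> : expR 2 = expR 1 ^+ 2 :> R by rewrite -expRM_natl mulr1.
  rewrite expRN [expR (-1)]expRN.
  have e1 : expR 1 != 0 :> R by rewrite expR_eq0.
  have e2 : expR k%:R != 0 :> R by rewrite expR_eq0.
  have k1' : k%:R + 1 != 0 :> R by rewrite gt_eqF// ltr_wpDr.
  rewrite [_ ^+ (2 * k).+1]exprS [(2 * k)%N]mulnC exprM [((k%:R + 1) / k%:R) ^+ k]expr_div_n.
  have kk : k%:R ^+ k != 0 :> R by rewrite expf_neq0.
  move: (k%:R ^+ k) kk => kk kk0.
  field.
  by rewrite kk0 kn0 F0 e1 e2 k1'.
apply: ler_peMr; first by rewrite mulr_ge0 ?ler0n ?sqr_ge0.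
rewrite ler_pdivlMr ?expR_gt0// mul1r.
(* This [z] satisfies [(1 + z) / (1 - z) = (k + 1) / k] and [(2k + 1) * 2z = 2], so [expR2_le]
   raised to the power [2k + 1] is the claim. *)
pose z : R := (2 * k%:R + 1)^-1.
have d0 : 0 < 2 * k%:R + 1 :> R by lra.
have z0 : 0 <= z by rewrite invr_ge0 ltW.
have := expR2_le z0.
have -> : 1 - z = 2 * k%:R / (2 * k%:R + 1) by rewrite /z; field; rewrite gt_eqF.
have -> : 1 + z = 2 * (k%:R + 1) / (2 * k%:R + 1) by rewrite /z; field; rewrite gt_eqF.
move=> h.
have : expR (2 * z) <= (k%:R + 1) / k%:R.
  rewrite ler_pdivlMr//.
  have : 0 < (2 * k%:R + 1)^-1 :> R by rewrite invr_gt0.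
  move: (_^-1) h => d h dp.
  have : 2 * (k%:R * expR (2 * z)) <= 2 * (k%:R + 1).
    by rewrite -(ler_pM2r dp); lra.
  lra.
move=> h2.
have -> : 2 = (2 * k).+1%:R * (2 * z) :> R.
  by rewrite -[(2 * k).+1%:R]natr1 natrM /z; field; rewrite gt_eqF.
rewrite expRM_natl lerXn2r ?nnegrE ?expR_ge0//.
Qed.

End Stirling.

(** * Square roots of Poisson masses to the left of the mode *)

Section Poisson.
Context {R : realType}.
Implicit Types (x t B : R) (i m n : nat).

(* The square of [qpois x i] is the mass at [i] of the Poisson law of mean [x ^+ 2]. *)
Definition qpois x i : R := expR (- (x ^+ 2) / 2) * x ^+ i / Num.sqrt (i`!)%:R.

Definition qratio x i : R := x / Num.sqrt i.+1%:R.

Lemma qpois_gt0 x i : 0 < x -> 0 < qpois x i.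
Proof.
by move=> x0; rewrite divr_gt0 ?mulr_gt0 ?expR_gt0 ?exprn_gt0// sqrtr_gt0 ltr0n fact_gt0.
Qed.

Lemma qpoisS x i : qpois x i.+1 = qratio x i * qpois x i.
Proof.
rewrite /qpois /qratio factS natrM sqrtrM ?ler0n// invfM [x ^+ i.+1]exprS; ring.
Qed.

Lemma sqr_qratio x i : i.+1%:R * qratio x i ^+ 2 = x ^+ 2.
Proof.
rewrite /qratio expr_div_n sqr_sqrtr ?ler0n// mulrC divfK// pnatr_eq0//.
Qed.

Lemma sqr_qpois x i : qpois x i ^+ 2 = expR (- x ^+ 2) * (x ^+ 2) ^+ i / i`!%:R.
Proof.
rewrite /qpois expr_div_n sqr_sqrtr ?ler0n// exprMn -!exprM mulnC -expRM_natr.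
by congr (expR _ * _ / _); lra.
Qed.

Lemma qpois_le1 x i : 0 < x -> qpois x i <= 1.
Proof.
move=> x0; rewrite -(@expr_le1 _ 2)// ?(ltW (qpois_gt0 _ x0))// sqr_qpois.
rewrite expRN -mulrA mulrC ler_pdivrMr ?expR_gt0// mul1r.
have x20 : 0 <= x ^+ 2 by rewrite sqr_ge0.
case: i => [|i]; first by rewrite fact0 divr1 expr0 -expR0 ler_expR.
by apply: le_trans (expR_ge1Dxn i x20); rewrite lerDr.
Qed.

(** With [m] the integer part of [x^2], passing from mean [x^2] to mean [m] costs at most a factor
    [e] in the mass at [m]. [stirling_lower] bounds the latter below by [e^(-1) / sqrt m], and
    [sqrt m <= x]. *)
Lemma qpois_mode_lower x : 1 <= x ->
  expR (- 2) <= x * qpois x (Num.truncn (x ^+ 2)) ^+ 2.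
Proof.
move=> x1; have x21 : 1 <= x ^+ 2 by rewrite exprn_ege1.
have x20 : 0 <= x ^+ 2 by lra.
set m := Num.truncn _.
have /andP[m1 m2] := truncn_itv x20; rewrite -/m in m1 m2.
have m0 : (0 < m)%N by rewrite truncn_gt0.
rewrite sqr_qpois.
have E : 0 <= expR (- m%:R) * m%:R ^+ m / m`!%:R :> R.
  by rewrite !mulr_ge0 ?expR_ge0 ?invr_ge0 ?exprn_ge0.
have h1 : expR (-1) * (expR (- m%:R) * m%:R ^+ m / m`!%:R) <=
  expR (- x ^+ 2) * (x ^+ 2) ^+ m / m`!%:R.
  rewrite !mulrA ler_wpM2r ?invr_ge0// -expRD ler_pM ?expR_ge0 ?exprn_ge0//.
    by rewrite ler_expR -natr1 in m2 *; lra.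
  by rewrite lerXn2r ?nnegrE.
have h2 := @stirling_lower R m m0.
set p := expR (- m%:R) * _ / _ in E h1 h2.
set r := expR (- x ^+ 2) * _ / _ in h1 *.
have e1 := expR_gt0 (-1 : R).
have r0 : 0 <= r by apply: le_trans h1; rewrite mulr_ge0 ?expR_ge0.
have xr0 : 0 <= x * r by apply: mulr_ge0 => //; lra.
rewrite -(@ler_pXn2r _ 2)// ?nnegrE ?expR_ge0//.
apply: (@le_trans _ _ (expR (- 2) * (m%:R * p ^+ 2))).
  by rewrite expr2 ler_wpM2l// expR_ge0.
have -> : expR (- 2) = expR (-1) ^+ 2 :> R by rewrite -expRM_natr; congr expR; lra.
have : (expR (-1) * p) ^+ 2 <= r ^+ 2 by rewrite lerXn2r ?nnegrE// mulr_ge0// ltW.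
have : m%:R * (expR (-1) * p) ^+ 2 <= x ^+ 2 * (expR (-1) * p) ^+ 2.
  by rewrite ler_wpM2r ?sqr_ge0.
move=> h3 h4; have : x ^+ 2 * (expR (-1) * p) ^+ 2 <= x ^+ 2 * r ^+ 2 by rewrite ler_wpM2l.
rewrite !exprMn in h3 h4 *; lra.
Qed.

Lemma qratio_le x B i : 0 < x -> 1 <= B -> 10 * B <= x ->
  x ^+ 2 - 5 * B * x <= i.+1%:R -> qratio x i - 1 <= 5 * (B * x^-1).
Proof.
move=> x0 B1 Bx h1.
set w := B * x^-1.
have w0 : 0 < w by rewrite mulr_gt0 ?invr_gt0//; lra.
have w1 : w <= 10^-1 by rewrite ler_pdivrMr//; lra.
have xw : B * x = x ^+ 2 * w by rewrite /w expr2; field; rewrite gt_eqF.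
have s0 : 0 < Num.sqrt i.+1%:R :> R by rewrite sqrtr_gt0 ltr0n.
have ss : Num.sqrt i.+1%:R ^+ 2 = i.+1%:R :> R by rewrite sqr_sqrtr.
rewrite /qratio; move: (Num.sqrt _) s0 ss => s s0 ss.
have x20 : 0 < x ^+ 2 by rewrite exprn_gt0.
suff : x <= s * (1 + 5 * w) by rewrite lerBlDr ler_pdivrMr//; lra.
rewrite -(@ler_pXn2r _ 2)// ?nnegrE ?mulr_ge0//; try lra.
rewrite exprMn ss.
apply: (@le_trans _ _ ((x ^+ 2 * (1 - 5 * w)) * (1 + 5 * w) ^+ 2)).
  rewrite -mulrA ler_peMr ?(ltW x20)//; nra.
by rewrite ler_wpM2r ?sqr_ge0//; lra.
Qed.

Lemma qratio_ge x B i : 0 < x -> 1 <= B -> 10 * B <= x ->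
  i.+1%:R <= x ^+ 2 - B * x -> B * x^-1 / 2 <= qratio x i - 1.
Proof.
move=> x0 B1 Bx h2.
set w := B * x^-1.
have w0 : 0 < w by rewrite mulr_gt0 ?invr_gt0//; lra.
have w1 : w <= 10^-1 by rewrite ler_pdivrMr//; lra.
have xw : B * x = x ^+ 2 * w by rewrite /w expr2; field; rewrite gt_eqF.
have s0 : 0 < Num.sqrt i.+1%:R :> R by rewrite sqrtr_gt0 ltr0n.
have ss : Num.sqrt i.+1%:R ^+ 2 = i.+1%:R :> R by rewrite sqr_sqrtr.
rewrite /qratio; move: (Num.sqrt _) s0 ss => s s0 ss.
have x20 : 0 < x ^+ 2 by rewrite exprn_gt0.
suff : s * (1 + w / 2) <= x by rewrite lerBrDr ler_pdivlMr//; lra.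
rewrite -(@ler_pXn2r _ 2)// ?nnegrE ?mulr_ge0//; try lra.
rewrite exprMn ss.
apply: (@le_trans _ _ ((x ^+ 2 * (1 - w)) * (1 + w / 2) ^+ 2)).
  by rewrite ler_wpM2r ?sqr_ge0//; lra.
rewrite -mulrA ler_piMr ?(ltW x20)//; nra.
Qed.

Lemma qratio_ge1 x i : 0 < x -> i.+1%:R <= x ^+ 2 -> 1 <= qratio x i.
Proof.
move=> x0 h; rewrite /qratio ler_pdivlMr ?sqrtr_gt0 ?ltr0n// mul1r.
by rewrite -[leRHS](ger0_norm (ltW x0)) -sqrtr_sqr ler_sqrt// sqr_ge0.
Qed.

(** From [i] to the mode there are at most [6 B x] steps, each multiplying [qpois x] by a ratio
    between [1] and [1 + 5 B / x]; the total growth is at most [exp (30 B^2)]. *)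
Lemma qpois_window x B i : 0 < x -> 1 <= B -> 10 * B <= x ->
  x ^+ 2 - 5 * B * x <= i.+1%:R -> i.+1%:R <= x ^+ 2 ->
  expR (- (30 * B ^+ 2)) * qpois x (Num.truncn (x ^+ 2)) <= qpois x i
    <= qpois x (Num.truncn (x ^+ 2)).
Proof.
move=> x0 B1 Bx h1 h2; set m := Num.truncn _.
have x20 : 0 <= x ^+ 2 by rewrite sqr_ge0.
have /andP[m1 m2] := truncn_itv x20; rewrite -/m in m1 m2.
have im : (i < m.+1)%N.
  by rewrite -(ltr_nat R); apply: le_lt_trans m2; rewrite (le_trans _ h2)// ler_nat.
have q0 l := qpois_gt0 l x0.
pose w := 5 * (B * x^-1).
have w0 : 0 < w by rewrite !mulr_gt0 ?invr_gt0//; lra.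
have key e : (i + e <= m)%N -> qpois x i <= qpois x (i + e) <= (1 + w) ^+ e * qpois x i.
  elim: e => [|e IH] hd; first by rewrite addn0 expr0 mul1r lexx.
  have /andP[k1 k2] := IH (leq_trans (leq_add (leqnn _) (leqnSn _)) hd).
  have g1 : 1 <= qratio x (i + e).
    by apply: qratio_ge1 => //; apply: le_trans m1; rewrite ler_nat -addnS.
  have g2 : qratio x (i + e) <= 1 + w.
    rewrite -lerBlDl; apply: qratio_le => //; apply: le_trans h1 _.
    by rewrite ler_nat ltnS leq_addr.
  have p0 := q0 (i + e)%N.
  rewrite addnS qpoisS; apply/andP; split.
    by apply: le_trans k1 _; rewrite ler_peMl// ltW.
  by rewrite exprS -mulrA ler_pM// ?(ltW p0)//; lra.
have := key (m - i)%N; rewrite subnKC// => /(_ (leqnn _)) /andP[k1 k2].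
rewrite k1 andbT expRN ler_pdivrMl ?expR_gt0//.
apply: le_trans k2 _; rewrite ler_wpM2r ?(ltW (q0 _))//.
apply: (@le_trans _ _ (expR w ^+ (m - i))).
  by rewrite lerXn2r ?nnegrE ?expR_ge0 ?expR_ge1Dx//; lra.
rewrite -expRM_natr ler_expR.
have : (m - i)%:R <= 6 * B * x.
  rewrite natrB; last by rewrite -ltnS.
  by rewrite -natr1 in h1; nra.
move=> h3; apply: le_trans (ler_wpM2l (ltW w0) h3) _.
by rewrite /w le_eqVlt; apply/orP; left; apply/eqP; field; rewrite gt_eqF.
Qed.

End Poisson.

(** * Lower bound for the phase sum *)

Section PhaseSum.
Context {R : realType}.

(** The hypothesis [B |t2| <= 2 l] controls [t2] by [l]; since [|i - x^2| / x <= 5B + 1] on the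
    window, it also controls [t1]. So [l] is comparable with [|t1| + |t2|]. *)
Lemma affine_window (x B t1 t2 : R) (i : nat) :
  0 < x -> 1 <= B -> 200 * B <= x ->
  x ^+ 2 - 5 * B * x <= i.+1%:R -> i.+1%:R <= x ^+ 2 - B * x ->
  0 < `|t1| + `|t2| ->
  let l := t1 + t2 * ((i%:R - x ^+ 2) / x) in
  B * `|t2| <= 2 * l ->
  [/\ `|t1| + `|t2| <= 15 * l, 0 < l & l <= 6 * B * (`|t1| + `|t2|)].
Proof.
move=> x0 B1 Bx v1 v2 La0 l H.
have t20 := normr_ge0 t2; have t10 := normr_ge0 t1.
set u := (i%:R - x ^+ 2) / x in l H *.
have uB : `|u| <= 5 * B + 1.
  rewrite /u normrM normfV (gtr0_norm x0) ler_pdivrMr// ler_norml.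
  rewrite -natr1 in v1 v2; have Bx0 : 0 <= B * x by rewrite mulr_ge0//; lra.
  by clear - v1 v2 Bx0 Bx B1 x0; apply/andP; split; lra.
have tu' : `|t2 * u| <= `|t2| * (5 * B + 1) by rewrite normrM ler_wpM2l.
have L0 : 0 <= l.
  by rewrite -(@pmulr_rge0 _ 2)//; apply: le_trans H; rewrite mulr_ge0//; lra.
have e1 : `|t1| <= l + `|t2 * u|.
  by rewrite -[t1](addrK (t2 * u)) (le_trans (ler_normB _ _))// lerD2r -/l ger0_norm.
have e2 : l <= `|t1| + `|t2 * u|.
  by rewrite (le_trans (ler_norm _))// ler_normD.
clearbody l.
have t2B : `|t2| <= B * `|t2| by rewrite ler_peMl.
have t1B : `|t1| <= B * `|t1| by rewrite ler_peMl.
move: (`|t2 * u|) (`|t1|) (`|t2|) tu' e1 e2 t2B t1B H t20 t10 La0 => v w z.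
by clear - B1 L0 => *; split; lra.
Qed.

Lemma integer_window (x B t J : R) (j : nat) : J = j%:R ->
  1 <= B -> 0 <= J -> 200 * B <= x -> 100 * (J + 1) <= x -> 2 <= t <= 5 ->
  exists a l : nat, [/\ (0 < a)%N, B * x / 4 <= l%:R,
    a%:R + l%:R <= x ^+ 2 &
    forall i, (a <= i <= a + l + j)%N ->
    [/\ x ^+ 2 - t * B * x <= i.+1%:R, i.+1%:R <= x ^+ 2 - (t - 1) * B * x,
     x ^+ 2 - 5 * B * x <= i.+1%:R & i.+1%:R <= x ^+ 2 - B * x]].
Proof.
move=> Jj B1 J0 Bx Jx /andP[tl tu].
have x0 : 0 <= x by lra.
have x200 : x <= B * x by rewrite ler_peMl.
have xx : 200 * (B * x) <= x ^+ 2 by rewrite expr2 mulrA ler_wpM2r.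
set z := B * x in x200 xx.
have z0 : 0 <= z by lra.
have t1 : t * z <= 5 * z by rewrite ler_wpM2r.
have t2 : 2 * z <= t * z by rewrite ler_wpM2r.
have tB0 : 0 <= x ^+ 2 - t * z by lra.
(* The real window has width [z = B x]. Only half of it is used for [l], leaving room for the [j]
   extra indices and for rounding. The lower bounds hold although [a] is rounded down, because they
   concern [i + 1]. *)
exists (Num.truncn (x ^+ 2 - t * z)), (Num.truncn (z / 2)).
have /andP[a1 a2] := truncn_itv tB0.
have Bx20 : 0 <= z / 2 by lra.
have /andP[l1 l2] := truncn_itv Bx20.
rewrite -[_.+1%:R]natr1 in a2; rewrite -[(Num.truncn _).+1%:R]natr1 in l2.
set a := Num.truncn (x ^+ 2 - t * z) in a1 a2 *.
set l := Num.truncn (z / 2) in l1 l2 *.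
have zz : 50 * (J + 1) <= z / 2 by lra.
split.
- rewrite -(ltr_nat R); lra.
- by rewrite -/z; lra.
- lra.
- move=> i; rewrite -!(ler_nat R) -natr1 !natrD -Jj => /andP[ai ib].
  rewrite mulrBl mul1r mulrBl -!mulrA -/z.
  by clear - a1 a2 l1 l2 zz ai ib t1 t2 z0 J0; split; lra.
Qed.

(* The step [h] is maximal among those keeping the [J]-th difference, of size
   [A (h/x)^J], below [1 / c2], hence that difference is not small either. *)
Lemma step_choice (x c2 A : R) (j l : nat) : let J := j.+1 in
  0 < x -> 1 <= c2 -> 0 < A -> c2 * A <= x ^+ J -> (2 * J <= l)%N -> x / 4 <= l%:R ->
  exists h : nat, [/\ c2 * A * (h%:R / x) ^+ J <= 1, (2 * (J * h) <= l)%N &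
    c2^-1 * (16 * J%:R * 2)^-1 ^+ J * Num.min A 1 <= A * (h%:R / x) ^+ J].
Proof.
move=> J x0 c21 A0 cA Jl xl.
pose P h := (c2 * A * h%:R ^+ J <= x ^+ J) && (2 * (J * h) <= l)%N.
have P1 : exists h, P h by exists 1%N; rewrite /P expr1n mulr1 cA muln1.
have Pl h : P h -> (h <= l)%N.
  move=> /andP[_]; apply: leq_trans.
  by rewrite mulnA leq_pmull// muln_gt0.
case: (ex_maxnP P1 Pl) => h /andP[h1 h2] hmax.
have xJ : 0 < x ^+ J by rewrite exprn_gt0.
exists h; split => //.
  by rewrite expr_div_n mulrA ler_pdivrMr// mul1r.
have h0 : (0 < h)%N by apply: hmax; rewrite /P expr1n mulr1 cA muln1.
have c20 : 0 < c2 by lra.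
have J1 : 1 <= J%:R :> R by rewrite ler1n.
have C0 : 0 <= (16 * J%:R * 2)^-1 ^+ J :> R.
  by rewrite exprn_ge0// invr_ge0 !mulr_ge0.
have c2i : c2^-1 <= 1 by rewrite invf_le1.
have hS : h.+1%:R <= 2 * h%:R :> R by rewrite -natrM ler_nat mul2n -addnn -addn1 leq_add2l.
have : ~~ P h.+1 by apply/negP => /hmax; rewrite ltnn.
(* The step [h + 1] is inadmissible for one of two reasons, matching the two entries of the minimum.
   If the difference would be too large, [h + 1 <= 2h] makes it at least [c2^-1 2^-J] at [h]. If the
   window would be too short, then [h / x >= 1 / (16 J)] and the factor [A] remains. *)
rewrite negb_and -ltNge -ltnNge => /orP[hx|hl].
  have k1 : x ^+ J < c2 * A * (2 * h%:R) ^+ J.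
    apply: lt_le_trans hx _; rewrite ler_wpM2l ?mulr_ge0 ?(ltW A0) ?(ltW c20)//.
    by rewrite lerXn2r ?nnegrE ?mulr_ge0.
  have k2 : c2^-1 * (2^-1) ^+ J <= A * (h%:R / x) ^+ J.
    rewrite expr_div_n exprVn mulrA ler_pdivlMr// -invfM mulrC ler_pdivrMr; last first.
      by rewrite mulr_gt0 ?exprn_gt0.
    by move: (ltW k1); rewrite exprMn; move: (_ ^+ J) (_ ^+ J) (_ ^+ J) => *; lra.
  apply: le_trans k2; rewrite -[leRHS]mulr1 ler_pM//.
  - by rewrite mulr_ge0 ?invr_ge0 ?(ltW c20).
  - by rewrite le_min (ltW A0) ler01.
  - rewrite ler_wpM2l ?invr_ge0 ?(ltW c20)// lerXn2r ?nnegrE ?invr_ge0 ?mulr_ge0//.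
    by rewrite lef_pV2 ?posrE ?mulr_gt0//; lra.
  - by rewrite ge_min lexx orbT.
have k1 : l%:R <= 2 * (J%:R * (2 * h%:R)) :> R.
  apply: (@le_trans _ _ (2 * (J%:R * h.+1%:R))).
    by rewrite -!natrM ler_nat ltnW.
  by rewrite !ler_wpM2l//; lra.
have k2 : (16 * J%:R)^-1 <= h%:R / x.
  rewrite ler_pdivlMr// mulrC ler_pdivrMr; last by rewrite mulr_gt0//; lra.
  lra.
rewrite [leRHS](_ : _ = 1 * (h%:R / x) ^+ J * A); last by ring.
rewrite ler_pM//.
- by rewrite mulr_ge0 ?invr_ge0 ?(ltW c20).
- by rewrite le_min (ltW A0) ler01.
- rewrite ler_pM ?invr_ge0 ?(ltW c20)//.
  rewrite lerXn2r ?nnegrE ?invr_ge0 ?mulr_ge0 ?invr_ge0 ?(ltW x0)//.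
  apply: le_trans k2; rewrite lef_pV2 ?posrE ?mulr_gt0//; try lra.
- by rewrite ge_min lexx.
Qed.

(** This is [affine_fdiff_bound] with [y = 1/x], [q = qpois x] and [eps = qratio x - 1], whose
    differences are bounded by [sqrt_ratio_fdiff_bound]. [affine_window] and [qpois_window] then
    replace the affine factor by [|t1| + |t2|] and [qpois x i] by its value at the mode, up to
    constants. *)
Lemma phase_fdiff_bound j : exists B c1 c2 : R,
  [/\ 1 <= B, 0 < c1 & 1 <= c2] /\
  forall (x t1 t2 A : R) (a b : nat),
  A = (`|t1| + `|t2|) * qpois x (Num.truncn (x ^+ 2)) ->
  200 * B <= x -> 10 * j.+1%:R * B <= x ->
  0 < `|t1| + `|t2| ->
  (forall i, (a <= i <= b)%N ->
    [/\ x ^+ 2 - 5 * B * x <= i.+1%:R, i.+1%:R <= x ^+ 2 - B * x &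
     B * `|t2| <= 2 * (t1 + t2 * ((i%:R - x ^+ 2) / x))]) ->
  forall i, (a <= i)%N -> (i + j.+1 <= b)%N ->
  c1 * (A * x^-1 ^+ j.+1) <=
  iter j.+1 (fdiff 1)
    (fun i => (t1 + t2 * ((i%:R - x ^+ 2) / x)) * qpois x i) i <=
  c2 * (A * x^-1 ^+ j.+1).
Proof.
have [K [K1 HK]] := @sqrt_ratio_fdiff_bound R j.+1.
have [B [B1 HB]] := affine_fdiff_bound j K1.
set J := j.+1.
have J1 : 1 <= J%:R :> R by rewrite ler1n.
pose kap : R := expR (- (30 * B ^+ 2)).
have kap0 : 0 < kap by exact: expR_gt0.
exists B, (30^-1 * (B / 4) ^+ J * kap), (12 * B * (10 * B) ^+ J).
have c10 : 0 < 30^-1 * (B / 4) ^+ J * kap.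
  apply: mulr_gt0 => //; apply: mulr_gt0; first by rewrite invr_gt0.
  by apply: exprn_gt0; lra.
have c21 : 1 <= 12 * B * (10 * B) ^+ J.
  have : 1 <= (10 * B) ^+ J by rewrite exprn_ege1//; lra.
  by move=> h; rewrite -[leLHS]mulr1; apply: ler_pM => //; lra.
split; first by split.
move=> x t1 t2 A a b AE Bx hx La0 win i ai iJ.
have x0 : 0 < x by lra.
set La_ := `|t1| + `|t2| in La0 AE *.
pose L (i : nat) : R := t1 + t2 * ((i%:R - x ^+ 2) / x).
pose y := x^-1; have y0 : 0 < y by rewrite invr_gt0.
have ab : (a <= i <= b)%N by rewrite ai (leq_trans _ iJ)// leq_addr.
have LS l : L l.+1 - L l = t2 * y.
  by rewrite /L -natr1 /y; field; rewrite gt_eqF.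
have rb l : (a <= l <= b)%N -> B * y / 2 <= qratio x l - 1 <= 5 * (B * y).
  by move=> /win[w1 w2 _]; rewrite qratio_ge ?qratio_le//; lra.
have Lw l : (a <= l <= b)%N -> [/\ La_ <= 15 * L l, 0 < L l & L l <= 6 * B * La_].
  by move=> /win[w1 w2 w3]; apply: affine_window.
pose Q := qpois x (Num.truncn (x ^+ 2)).
have Q0 : 0 < Q by exact: qpois_gt0.
have /andP[q1 q2] : kap * Q <= qpois x i <= Q.
  have [w1 w2 _] := win i ab; apply: qpois_window => //; first lra.
  by apply: le_trans w2 _; rewrite gerBl mulr_ge0//; lra.
have Bxx : B * x^-1 <= 200^-1 by rewrite ler_pdivrMr//; lra.
have := HB B y (t2 * y) (qpois x) (fun i => qratio x i - 1) L a b (lexx B) y0.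
case/(_ _ _ _ _ rb _ LS _ i ai iJ)/andP.
- by rewrite /y mulrA ler_pdivrMr// mul1r.
- by rewrite /y; lra.
- by move=> l; rewrite addrC subrK qpoisS.
- by move=> l _; exact: qpois_gt0.
- move=> [//|k] l kJ al lb.
  rewrite iterSr (_ : fdiff 1 _ = fdiff 1 (qratio x)); last first.
    by apply: funext => s; rewrite /fdiff; ring.
  rewrite -iterSr /y exprVn; apply: (HK x (qratio x) a b) => //.
  + move=> s /win[w1 w2 _].
    have : 5 * B * x <= x * x / 2 by rewrite [leRHS]mulrAC ler_wpM2r//; clear - Bx x0; lra.
    by rewrite -expr2; lra.
  + move=> s sab; have /andP[r1 r2] := rb s sab.
    have : 0 < B * y by rewrite mulr_gt0//; lra.
    by rewrite /y in r1 r2 *; move=> By0; clear - r1 r2 Bxx By0; apply/andP; split; lra.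
  + by move=> s; exact: sqr_qratio.
- move=> l lab; have [_ L0 _] := Lw l lab; have [_ _ LB] := win l lab; split => //.
  rewrite normrM (gtr0_norm y0) mulrA [leRHS](_ : _ = (2 * L l) * y); last by ring.
  by rewrite ler_wpM2r// ltW.
have [g1 g2 g3] := Lw i ab.
rewrite -/(L i) => h1 h2; apply/andP; split.
  apply: le_trans h1; rewrite AE.
  have -> : 30^-1 * (B / 4) ^+ J * kap * (La_ * Q * y ^+ J) =
     (2^-1 * (La_ / 15)) * ((B * y / 4) ^+ J * (kap * Q)).
    by rewrite !exprMn; field.
  have z0 : 0 <= (B * y / 4) ^+ J by rewrite exprn_ge0// !mulr_ge0 ?(ltW y0)//; lra.
  apply: ler_pM; [clear - La0; lra| by apply: mulr_ge0 => //; apply: mulr_ge0; exact: ltW|clear - g1; lra|].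
  by rewrite ler_wpM2l.
apply: le_trans h2 _; rewrite AE.
have -> : 12 * B * (10 * B) ^+ J * (La_ * Q * y ^+ J) =
   (2 * (6 * B * La_)) * ((10 * (B * y)) ^+ J * Q).
  by rewrite !exprMn; ring.
have z0 : 0 <= (10 * (B * y)) ^+ J by rewrite exprn_ge0// !mulr_ge0 ?(ltW y0)//; lra.
apply: ler_pM; [clear - g2; lra| by apply: mulr_ge0 => //; apply/ltW/qpois_gt0|clear - g3; lra|].
by rewrite ler_wpM2l.
Qed.

(** With the step from [step_choice], [sum_cos_fdiff_ge] on a window of about [B x / 2] indices
    gives a sum of order at least [x min(A, 1)^2]. Here [A] is [|t1| + |t2|] times the mode value
    [Q], and [x Q^2] is bounded below by [qpois_mode_lower]. *)
Lemma phase_sum_window j : exists B c x0 : R,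
  [/\ 1 <= B, 0 < c & 200 * B <= x0] /\
  forall (x t t1 t2 : R) n, x0 <= x -> 2 <= t <= 5 -> x ^+ 2 <= n%:R ->
  0 < `|t1| + `|t2| -> `|t1| + `|t2| <= c * x ^+ j.+1 ->
  (forall i : nat, x ^+ 2 - t * B * x <= i.+1%:R ->
     i.+1%:R <= x ^+ 2 - (t - 1) * B * x ->
     B * `|t2| <= 2 * (t1 + t2 * ((i%:R - x ^+ 2) / x))) ->
  c * Num.min ((`|t1| + `|t2|) ^+ 2) x <=
  \sum_(1 <= i < n.+1) (1 - cos (qpois x i * (t1 + t2 * ((i%:R - x ^+ 2) / x)))).
Proof.
have [B [c1 [c2 [[B1 c10 c21] H]]]] := phase_fdiff_bound j.
set J := j.+1.
have J1 : 1 <= J%:R :> R by rewrite ler1n.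
pose c3 : R := c2^-1 * (16 * J%:R * 2)^-1 ^+ J.
pose D : R := 4^-1 ^+ J / 64 * (c1 * c3) ^+ 2.
have c20 : 0 < c2 by lra.
have c30 : 0 < c3.
  by rewrite mulr_gt0 ?invr_gt0// exprn_gt0// invr_gt0 !mulr_gt0//; lra.
have D0 : 0 < D.
  apply: mulr_gt0; last by apply/exprn_gt0/mulr_gt0.
  by apply: divr_gt0 => //; apply: exprn_gt0; rewrite invr_gt0.
pose c : R := Num.min c2^-1 (D * expR (- 2)).
have cc2 : c <= c2^-1 by rewrite ge_min lexx.
have cD : c <= D * expR (- 2) by rewrite ge_min lexx orbT.
have c0 : 0 < c by rewrite lt_min invr_gt0 c20 mulr_gt0 ?expR_gt0.
clearbody c.
exists B, c, (200 * (J%:R + 1) * B); split.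
  by split => //; rewrite ler_wpM2r//; lra.
move=> x t t1 t2 n hx ht xn La0 La HL.
have Bx1 : 200 * (J%:R + 1) <= x by apply: le_trans hx; rewrite ler_peMr//; lra.
have Bx2 : 200 * B <= x by apply: le_trans hx; rewrite ler_wpM2r//; lra.
have Bx3 : 10 * J%:R * B <= x by apply: le_trans hx; rewrite ler_wpM2r//; lra.
have x0 : 0 < x by lra.
have [||a [l [a0 lx alx win]]] := @integer_window x B t J%:R J erefl B1 _ Bx2 _ ht; [lra|lra|].
pose Q := qpois x (Num.truncn (x ^+ 2)).
have Q0 : 0 < Q by exact: qpois_gt0.
have x1 : 1 <= x by lra.
have Qx := qpois_mode_lower x1; rewrite -/Q in Qx.
have Q1 : Q <= 1 by exact: qpois_le1.
set La_ := `|t1| + `|t2| in La0 La *.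
pose A := La_ * Q.
have A0 : 0 < A by rewrite mulr_gt0.
have xJ : 0 < x ^+ J by rewrite exprn_gt0.
(* The polynomial bound on the frequency says that the unit step [h = 1] is already admissible in
   [step_choice]. *)
have c2A : c2 * A <= x ^+ J.
  rewrite mulrC -ler_pdivlMr// mulrC; apply: (@le_trans _ _ La_).
    by rewrite ler_piMr// ltW.
  by apply: le_trans La _; rewrite ler_wpM2r// ltW.
have xl : x / 4 <= l%:R.
  by apply: le_trans lx; rewrite ler_wpM2r// ler_peMl// ltW.
have Jl : (2 * J <= l)%N.
  rewrite -(ler_nat R) natrM; lra.
have [h [h1 h2 h3]] := step_choice x0 c21 A0 c2A Jl xl.
rewrite -/J -/c3 in h3.
have fb i : (a <= i <= a + l)%N ->
   c1 * (A * x^-1 ^+ J) <= iter J (fdiff 1)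
    (fun i => (t1 + t2 * ((i%:R - x ^+ 2) / x)) * qpois x i) i <= c2 * (A * x^-1 ^+ J).
  move=> /andP[ai il]; apply: (H x t1 t2 A a (a + l + J)%N) => //.
    by move=> s /win[w1 w2 w3 w4]; split => //; exact: HL.
  by rewrite leq_add2r.
have := @sum_cos_fdiff_ge R (c1 * (A * x^-1 ^+ J)) (c2 * (A * x^-1 ^+ J)) J h _ a l _ _ h2 fb.
have hE c' : h%:R ^+ J * (c' * (A * x^-1 ^+ J)) = c' * (A * (h%:R / x) ^+ J).
  by rewrite exprMn; ring.
rewrite !hE mulrA.
have h4 : 0 <= c1 * (A * x^-1 ^+ J).
  apply: mulr_ge0; first exact: ltW.
  by apply: mulr_ge0; [exact: ltW | rewrite exprn_ge0// invr_ge0 ltW].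
move=> /(_ h4 h1) {h4 h1} S.
have pos (i : nat) : 0 <= 1 - cos (qpois x i * (t1 + t2 * ((i%:R - x ^+ 2) / x))).
  by rewrite subr_ge0 cos_le1.
(* The window lies to the left of the mode and [x^2 <= n], so it is inside the range of summation;
   the other terms are nonnegative. *)
have aln : (a + l <= n.+1)%N.
  by rewrite -(ler_nat R) natrD -natr1; clear - alx xn; lra.
apply: (@le_trans _ _ (\sum_(a <= i < a + l)
  (1 - cos (qpois x i * (t1 + t2 * ((i%:R - x ^+ 2) / x)))))); last first.
  rewrite [leRHS](@big_cat_nat _ _ _ a)//=; last by rewrite (leq_trans _ aln)// leq_addr.
  rewrite ler_wpDl ?sumr_ge0// [leRHS](@big_cat_nat _ _ _ (a + l)%N)//= ?leq_addr//.
  by rewrite lerDl sumr_ge0.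
under eq_bigr => i _ do rewrite mulrC.
apply: le_trans S.
set m := Num.min A 1 in h3.
have m0 : 0 < m by rewrite lt_min A0 ltr01.
apply: (@le_trans _ _ (D * (x * m ^+ 2))).
  apply: (@le_trans _ _ (D * expR (- 2) * Num.min (La_ ^+ 2) x)).
    by rewrite ler_wpM2r// le_min sqr_ge0 ltW.
  rewrite -mulrA ler_wpM2l ?(ltW D0)//.
  have e1 : expR (- 2) <= 1 :> R by rewrite expR_le1 oppr_le0.
  have e0 : 0 < expR (- 2) :> R by exact: expR_gt0.
  rewrite /m; have [A1|A1] := leP A 1.
    apply: (@le_trans _ _ (expR (- 2) * La_ ^+ 2)).
      by rewrite ler_wpM2l ?(ltW e0)// ge_min lexx.
    rewrite [leRHS](_ : _ = x * Q ^+ 2 * La_ ^+ 2); last by rewrite /A; ring.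
    by rewrite ler_wpM2r ?sqr_ge0.
  apply: (@le_trans _ _ (expR (- 2) * x)).
    by rewrite ler_wpM2l ?(ltW e0)// ge_min lexx orbT.
  by rewrite expr1n mulr1 ler_piMl// ltW.
have h6 : (c3 * m) ^+ 2 <= (A * (h%:R / x) ^+ J) ^+ 2.
  have ? : 0 <= c3 * m by rewrite mulr_ge0 ?ltW.
  by rewrite lerXn2r ?nnegrE// (le_trans _ h3).
rewrite /D; set w := A * _ in h6 *.
rewrite [leLHS](_ : _ = 4^-1 ^+ J * (x / 4) * (c1 ^+ 2 * (c3 * m) ^+ 2) / 16); last by field.
rewrite [(c1 * w) ^+ 2]exprMn ler_wpM2r ?invr_ge0//.
have p4 : 0 <= 4^-1 ^+ J :> R by rewrite exprn_ge0// invr_ge0.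
have k1 : 4^-1 ^+ J * (x / 4) <= 4^-1 ^+ J * l%:R by rewrite ler_wpM2l.
have k2 : c1 ^+ 2 * (c3 * m) ^+ 2 <= c1 ^+ 2 * w ^+ 2.
  by rewrite ler_wpM2l ?sqr_ge0.
apply: ler_pM => //; last by rewrite mulr_ge0 ?sqr_ge0.
by apply: mulr_ge0 => //; rewrite divr_ge0// ltW.
Qed.

(** The sign condition of [phase_sum_window] is met by choosing the window. With [t2 >= 0] and
    [u = (i - x^2)/x], compare [t1] with [3 B t2]: if it is larger, take [t = 2], where
    [u >= - 5B/2]; otherwise negate the frequency and take [t = 5], where [u <= - 7B/2]. Either way
    the affine factor is at least [B |t2| / 2]. *)
Lemma phase_sum_lower j : exists c x0 : R, [/\ 0 < c & 1 <= x0] /\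
  forall (x t1 t2 : R) n, x0 <= x -> x ^+ 2 <= n%:R ->
  `|t1| + `|t2| <= c * x ^+ j.+1 ->
  c * Num.min ((`|t1| + `|t2|) ^+ 2) x <=
  \sum_(1 <= i < n.+1) (1 - cos (qpois x i * (t1 + t2 * ((i%:R - x ^+ 2) / x)))).
Proof.
have [B [c [x0 [[B1 c0 Bx0] H]]]] := phase_sum_window j.
exists c, x0; split; first by split=> //; lra.
move=> x t1 t2 n xx0 xn La.
have x1 : 200 * B <= x by lra.
have x00 : 0 < x by lra.
have [La0|La0] := ltP 0 (`|t1| + `|t2|); last first.
  have -> : `|t1| + `|t2| = 0 by apply: le_anti; rewrite La0 addr_ge0.
  rewrite expr0n/= min_l ?(ltW x00)// mulr0; apply: sumr_ge0 => i _.
  by rewrite subr_ge0 cos_le1.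
wlog t20 : t1 t2 La La0 / 0 <= t2.
  move=> W; have [|/ltW t20] := leP 0 t2; first exact: W.
  have := W (- t1) (- t2); rewrite !normrN => /(_ La La0); rewrite oppr_ge0 => /(_ t20).
  congr (_ <= _); apply: eq_bigr => i _.
  by rewrite mulNr -opprD mulrN cosN.
have aux (i : nat) : t1 + t2 * ((i%:R - x ^+ 2) / x) =
   (t1 - 3 * B * t2) + t2 * ((i%:R - x ^+ 2) / x + 3 * B) by ring.
have [p|p] := leP 0 (t1 - 3 * B * t2).
  apply: (H x 2) => //; first by apply/andP; split; lra.
  move=> i v1 v2; rewrite aux (ger0_norm t20).
  have : B / 2 <= (i%:R - x ^+ 2) / x + 3 * B.
    rewrite -[i.+1%:R]natr1 in v1; rewrite -lerBlDr ler_pdivlMr//.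
    have : 200 * x <= 200 * B * x by rewrite ler_wpM2r//; lra.
    lra.
  move=> /(ler_wpM2l t20); lra.
have := H x 5 (- t1) (- t2) n xx0 _ xn; rewrite !normrN => /(_ _ La0 La).
rewrite -(eq_bigr _ (fun i _ => congr1 (fun z => 1 - z)
  (cosN (qpois x i * (t1 + t2 * ((i%:R - x ^+ 2) / x)))))).
have -> : \sum_(1 <= i < n.+1) (1 - cos (qpois x i * (- t1 + - t2 * ((i%:R - x ^+ 2) / x)))) =
  \sum_(1 <= i < n.+1) (1 - cos (- (qpois x i * (t1 + t2 * ((i%:R - x ^+ 2) / x))))).
  by apply: eq_bigr => i _; rewrite mulNr -opprD mulrN.
apply; first by apply/andP; split; lra.
move=> i v1 v2; rewrite mulNr -opprD aux (ger0_norm t20).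
have : (i%:R - x ^+ 2) / x + 3 * B <= - (B / 2).
  rewrite -[i.+1%:R]natr1 in v2; rewrite -lerBrDr ler_pdivrMr//.
  have : 200 * x <= 200 * B * x by rewrite ler_wpM2r//; lra.
  lra.
move=> /(ler_wpM2l t20); lra.
Qed.

End PhaseSum.

(** * Independence and characteristic functions *)

Section BoundedExpectation.
Context {R : realType} {d : measure_display} {T : measurableType d}.
Variable P : probability T R.
Implicit Types (f g Y Z : T -> R) (X : {RV P >-> R}).

Definition bounded_mfun f := measurable_fun setT f /\ exists M, forall w, `|f w| <= M.

Local Notation E f := (Rintegral P setT f).

Lemma bounded_mfun_integrable f : bounded_mfun f -> P.-integrable setT (EFin \o f).
Proof.
move=> [mf [M fM]]; apply: measurable_bounded_integrable => //.
  by apply: le_lt_trans (probability_le1 P measurableT) _; rewrite ltry.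
exists M; split; first exact: num_real.
by move=> y My w _ /=; apply: le_trans (fM w) (ltW My).
Qed.

Lemma bounded_mfun_cst (r : R) : bounded_mfun (fun=> r).
Proof. by split; [exact: measurable_cst | exists `|r|]. Qed.

Lemma bounded_mfunD f g : bounded_mfun f -> bounded_mfun g -> bounded_mfun (fun w => f w + g w).
Proof.
move=> [mf [M fM]] [mg [N gN]]; split; first exact: measurable_funD.
by exists (M + N) => w; rewrite (le_trans (ler_normD _ _))// lerD.
Qed.

Lemma bounded_mfunM f g : bounded_mfun f -> bounded_mfun g -> bounded_mfun (fun w => f w * g w).
Proof.
move=> [mf [M fM]] [mg [N gN]]; split; first exact: measurable_funM.
by exists (M * N) => w; rewrite normrM ler_pM.
Qed.

Lemma bounded_mfunB f g : bounded_mfun f -> bounded_mfun g -> bounded_mfun (fun w => f w - g w).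
Proof.
move=> [mf [M fM]] [mg [N gN]]; split; first exact: measurable_funB.
by exists (M + N) => w; rewrite (le_trans (ler_normB _ _))// lerD.
Qed.

Lemma bounded_mfun_sum I (r : seq I) (F : I -> T -> R) : (forall i, bounded_mfun (F i)) ->
  bounded_mfun (fun w => \sum_(i <- r) F i w).
Proof.
move=> bF; elim: r => [|i r IH].
  by under eq_fun do rewrite big_nil; exact: bounded_mfun_cst.
by under eq_fun do rewrite big_cons; exact: bounded_mfunD.
Qed.

Lemma bounded_mfun_indic (A : set T) : measurable A -> bounded_mfun \1_A.
Proof.
move=> mA; split; first exact: measurable_indic.
by exists 1 => w; rewrite indicE; case: (_ \in _); rewrite ?normr1// normr0.
Qed.

Lemma bounded_mfun_comp (g : R -> R) f : measurable_fun setT g ->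
  (exists M, forall x, `|g x| <= M) ->
  measurable_fun setT f -> bounded_mfun (fun w => g (f w)).
Proof.
move=> mg [M gM] mf; split; first exact: measurableT_comp.
by exists M => w.
Qed.

Lemma bounded_mfun_cos f : measurable_fun setT f -> bounded_mfun (fun w => cos (f w)).
Proof.
apply: bounded_mfun_comp; last by exists 1; exact: cos_max.
by apply: continuous_measurable_fun; exact: continuous_cos.
Qed.

Lemma bounded_RintegralD f g : bounded_mfun f -> bounded_mfun g ->
  E (fun w => f w + g w) = E f + E g.
Proof. by move=> bf bg; rewrite RintegralD//; exact: bounded_mfun_integrable. Qed.

Lemma bounded_RintegralB f g : bounded_mfun f -> bounded_mfun g ->
  E (fun w => f w - g w) = E f - E g.
Proof. by move=> bf bg; rewrite RintegralB//; exact: bounded_mfun_integrable. Qed.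

Lemma bounded_RintegralZl (r : R) f : bounded_mfun f -> E (fun w => r * f w) = r * E f.
Proof. by move=> bf; rewrite RintegralZl//; exact: bounded_mfun_integrable. Qed.

Lemma prob_Rintegral_cst (r : R) : E (fun=> r) = r.
Proof.
transitivity (r * fine (P setT)); first exact: Rintegral_cst.
by rewrite probability_setT mulr1.
Qed.

Lemma bounded_Rintegral_le f g : bounded_mfun f -> bounded_mfun g ->
  (forall w, f w <= g w) -> E f <= E g.
Proof. by move=> bf bg fg; apply: le_Rintegral => //; exact: bounded_mfun_integrable. Qed.

Lemma bounded_Rintegral_sum I (r : seq I) (F : I -> T -> R) : (forall i, bounded_mfun (F i)) ->
  E (fun w => \sum_(i <- r) F i w) = \sum_(i <- r) E (F i).
Proof.
move=> bF; elim: r => [|i r IH].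
  rewrite big_nil -[RHS](prob_Rintegral_cst 0); congr Rintegral.
  by apply: funext => w; rewrite big_nil.
rewrite big_cons -IH -bounded_RintegralD//; last exact: bounded_mfun_sum.
by congr Rintegral; apply: funext => w; rewrite big_cons.
Qed.

Lemma prob_Rintegral_indic (A : set T) : measurable A -> E \1_A = fine (P A).
Proof. by move=> mA; rewrite /Rintegral integral_indic// setIT. Qed.

Lemma bounded_Rintegral_dist f g (e : R) : bounded_mfun f -> bounded_mfun g ->
  (forall w, `|f w - g w| <= e) ->
  `|E f - E g| <= e.
Proof.
move=> bf bg fg; rewrite -bounded_RintegralB// ler_norml -{1 2}(prob_Rintegral_cst e).
rewrite -mulN1r -bounded_RintegralZl; last exact: bounded_mfun_cst.
have bfg := bounded_mfunB bf bg.
apply/andP; split; apply: bounded_Rintegral_le => //; try exact: bounded_mfun_cst.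
  by move=> w; have := fg w; rewrite ler_norml mulN1r => /andP[].
by move=> w; have := fg w; rewrite ler_norml => /andP[].
Qed.

(** The sum counts the positive integers up to [y], so it is the integer part of [y], written as a
    sum of threshold indicators. *)
Lemma count_le_nat (y : R) (n : nat) : 0 <= y <= n%:R ->
  y - 1 <= \sum_(l < n) (l.+1%:R <= y)%R%:R <= y.
Proof.
case/andP=> y0 yn; have /andP[t1 t2] := truncn_itv y0; set t := Num.truncn y in t1 t2.
have key m : \sum_(l < m) (l.+1%:R <= y)%R%:R = (minn m t)%:R :> R.
  elim: m => [|m IH]; first by rewrite big_ord0 min0n.
  rewrite big_ord_recr/= IH -natrD; congr (_%:R).
  have -> : (m.+1%:R <= y) = (m < t)%N.
    apply/idP/idP => [h|h]; last by apply: le_trans t1; rewrite ler_nat.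
    by rewrite -ltnS -(ltr_nat R); exact: le_lt_trans h t2.
  case: (ltnP m t) => h; first by rewrite (minn_idPl h) addn1.
  by rewrite addn0 (minn_idPr (leqW h)).
rewrite key (minn_idPr _); last by rewrite -(ler_nat R) (le_trans t1).
rewrite t1 andbT lerBlDr natr1; exact: ltW.
Qed.

(* A bounded measurable [g] is a uniform limit of combinations of indicators of its
   superlevel sets. *)
Lemma expectation_extend (Y : T -> R) (X X' : {RV P >-> R}) (c : R) : bounded_mfun Y ->
  (forall A : set R, measurable A ->
    E (fun w => Y w * \1_A (X w)) = c * E (fun w => \1_A (X' w))) ->
  forall g : R -> R, measurable_fun setT g -> (exists M, forall x, `|g x| <= M) ->
    E (fun w => Y w * g (X w)) = c * E (fun w => g (X' w)).
Proof.
move=> bY H g mg [M gM].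
have [mY [N YN]] := bY.
have bI (A : set R) (X0 : {RV P >-> R}) : measurable A -> bounded_mfun (fun w => \1_A (X0 w)).
  move=> mA; apply: bounded_mfun_comp => //.
  by exists 1 => w; rewrite indicE; case: (_ \in _); rewrite ?normr1// normr0.
have bg (X0 : {RV P >-> R}) : bounded_mfun (fun w => g (X0 w)).
  by apply: bounded_mfun_comp => //; exists M.
have EY : E Y = c.
  have := H setT measurableT.
  under [X in Rintegral _ _ X = _]eq_fun do rewrite indicT mulr1.
  by under [X in c * Rintegral _ _ X]eq_fun do rewrite indicT; rewrite prob_Rintegral_cst mulr1.
have N0 : 0 <= N by apply: le_trans (YN point).
have M0 : 0 <= M by apply: le_trans (gM 0).
suff key (K : R) : 0 < K ->
    `|E (fun w => Y w * g (X w)) - c * E (fun w => g (X' w))| <= (N + `|c|) / K.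
  apply/eqP; rewrite -subr_eq0 -normr_le0; apply/ler_addgt0Pr => e e0; rewrite add0r.
  have NC : 0 < N + `|c| + 1 by rewrite ltr_wpDl// addr_ge0.
  apply: le_trans (key ((N + `|c| + 1) / e) _) _; first by rewrite divr_gt0.
  by rewrite invf_div mulrA ler_pdivrMr// mulrC ler_wpM2l// ?ltW//; lra.
move=> K0.
pose n := (Num.truncn (K * (2 * M))).+1.
pose A (l : nat) : set R := g @^-1` `[l.+1%:R / K - M, +oo[.
have mA l : measurable (A l).
  by rewrite -[A l]setTI; apply: mg => //; exact: measurable_itv.
(* By [count_le_nat] applied to [K (g x + M)], [G - M] is [g] rounded down to a grid of mesh
   [1/K]. *)
pose G (x : R) : R := K^-1 * (\sum_(l < n) \1_(A l) x).
have GB x : `|g x - (G x - M)| <= K^-1.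
  have : 0 <= K * (g x + M) <= n%:R.
    have := gM x; rewrite ler_norml => /andP[g1 g2].
    rewrite mulr_ge0 ?(ltW K0)//=; last lra.
    have /truncn_itv/andP[_ h] : 0 <= K * (2 * M) by rewrite !mulr_ge0// ltW.
    by apply/ltW/(le_lt_trans _ h); rewrite ler_wpM2l ?(ltW K0)//; lra.
  move=> /count_le_nat.
  have -> : \sum_(l < n) (l.+1%:R <= K * (g x + M))%R%:R = \sum_(l < n) \1_(A l) x :> R.
    apply: eq_bigr => l _; rewrite indicE; congr (nat_of_bool _)%:R.
    apply/idP/idP => [h|].
      by apply/mem_set; rewrite /A /= in_itv/= andbT lerBlDr ler_pdivrMr// mulrC.
    by move/set_mem; rewrite /A /= in_itv/= andbT lerBlDr ler_pdivrMr// mulrC.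
  rewrite /G; move: (\sum_(l < n) _) => S /andP[s1 s2].
  rewrite (_ : g x - _ = K^-1 * (K * (g x + M) - S)); last by field; rewrite gt_eqF.
  by rewrite normrM gtr0_norm ?invr_gt0// ler_piMr ?invr_ge0 ?(ltW K0)// ger0_norm; lra.
have bG (X0 : {RV P >-> R}) : bounded_mfun (fun w => G (X0 w)).
  by apply: bounded_mfunM; [exact: bounded_mfun_cst | apply: bounded_mfun_sum => l; exact: bI].
have bGM (X0 : {RV P >-> R}) : bounded_mfun (fun w => G (X0 w) - M).
  by apply: bounded_mfunB => //; exact: bounded_mfun_cst.
have EG : E (fun w => Y w * (G (X w) - M)) = c * E (fun w => G (X' w) - M).
  rewrite bounded_RintegralB//; last exact: bounded_mfun_cst.
  rewrite prob_Rintegral_cst (_ : (fun w => _) = (fun w => Y w * G (X w) - M * Y w)); last first.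
    by apply: funext => w; ring.
  rewrite bounded_RintegralB; last 2 first.
  - exact: bounded_mfunM.
  - by apply: bounded_mfunM => //; exact: bounded_mfun_cst.
  rewrite bounded_RintegralZl// EY mulrBr (mulrC M); congr (_ - _).
  rewrite /G bounded_RintegralZl; last by apply: bounded_mfun_sum => l; exact: bI.
  rewrite (_ : (fun w => _) = (fun w => K^-1 * \sum_(l < n) Y w * \1_(A l) (X w))); last first.
    by apply: funext => w; rewrite mulrCA mulr_sumr.
  rewrite bounded_RintegralZl; last by apply: bounded_mfun_sum => l; apply: bounded_mfunM => //; exact: bI.
  rewrite mulrCA; congr (_ * _).
  rewrite !bounded_Rintegral_sum; [|by move=> l; exact: bI|by move=> l; apply: bounded_mfunM => //; exact: bI].
  by rewrite mulr_sumr; apply: eq_bigr => l _; exact: H.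
have d1 : `|E (fun w => Y w * g (X w)) - E (fun w => Y w * (G (X w) - M))| <= N * K^-1.
  apply: bounded_Rintegral_dist; [exact: bounded_mfunM|exact: bounded_mfunM|move=> w].
  by rewrite -mulrBr normrM ler_pM.
have d2 : `|E (fun w => G (X' w) - M) - E (fun w => g (X' w))| <= K^-1.
  by apply: bounded_Rintegral_dist => // w; rewrite distrC.
rewrite -[X in X - _](subrK (E (fun w => Y w * (G (X w) - M)))) {2}EG -addrA -mulrBr.
rewrite (le_trans (ler_normD _ _))// mulrDl lerD// normrM ler_wpM2l//.
Qed.

End BoundedExpectation.

(** * Product formula and decay for the characteristic function *)

Section Independence.
Context {R : realType} {d : measure_display} {T : measurableType d}.
Variable P : probability T R.
Variable xi : nat -> {RV P >-> R}.
Hypothesis xi_iid : iid xi.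
Implicit Types (Z : T -> R) (s : seq nat) (B : nat -> set R).

Local Notation E f := (Rintegral P setT f).

Definition cylinder s B : set T :=
  \bigcap_(i in [set j | j \in s]) (xi i @^-1` B i).

Lemma measurable_cylinder s B : (forall i, measurable (B i)) ->
  measurable (cylinder s B).
Proof.
move=> mB; apply: fin_bigcap_measurable; first exact: finite_seq.
by move=> i _; rewrite -[X in measurable X]setTI; exact: measurable_funP.
Qed.

Lemma cylinder_cons m s B : cylinder (m :: s) B = (xi m @^-1` B m) `&` cylinder s B.
Proof.
apply/seteqP; split => w.
  move=> H; split; first by apply: H; rewrite /= inE eqxx.
  by move=> i is_; apply: H; rewrite /= inE [i \in s]is_ orbT.
move=> [H1 H2] i /=; rewrite inE => /orP[/eqP ->//|is_]; exact: H2.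
Qed.

Lemma cylinder_ext s B B' : {in s, B =1 B'} -> cylinder s B = cylinder s B'.
Proof. by move=> BB; apply: eq_bigcapr => i /= is_; rewrite BB. Qed.

(* [Z] is independent of [(xi i)_(i >= m)], tested on finite cylinders. *)
Definition indep_tail m Z := bounded_mfun Z /\ forall s B, uniq s ->
  (forall i, i \in s -> (m <= i)%N) -> (forall i, measurable (B i)) ->
  E (fun w => Z w * \1_(cylinder s B) w) = E Z * fine (P (cylinder s B)).

Lemma indep_tail_cst m (r : R) : indep_tail m (fun=> r).
Proof.
split; first exact: bounded_mfun_cst.
move=> s B us ms mB.
have mC := measurable_cylinder s mB.
by rewrite bounded_RintegralZl ?prob_Rintegral_cst ?prob_Rintegral_indic//; exact: bounded_mfun_indic.
Qed.

Lemma indep_tailD m Z Z' : indep_tail m Z -> indep_tail m Z' ->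
  indep_tail m (fun w => Z w + Z' w).
Proof.
move=> [bZ HZ] [bZ' HZ']; split; first exact: bounded_mfunD.
move=> s B us ms mB; have bI := bounded_mfun_indic (measurable_cylinder s mB).
under [X in Rintegral _ _ X]eq_fun do rewrite mulrDl.
rewrite [LHS]bounded_RintegralD; [|exact: bounded_mfunM|exact: bounded_mfunM].
by rewrite HZ// HZ'// bounded_RintegralD// mulrDl.
Qed.

Lemma indep_tailB m Z Z' : indep_tail m Z -> indep_tail m Z' ->
  indep_tail m (fun w => Z w - Z' w).
Proof.
move=> [bZ HZ] [bZ' HZ']; split; first exact: bounded_mfunB.
move=> s B us ms mB; have bI := bounded_mfun_indic (measurable_cylinder s mB).
under [X in Rintegral _ _ X]eq_fun do rewrite mulrBl.
rewrite [LHS]bounded_RintegralB; [|exact: bounded_mfunM|exact: bounded_mfunM].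
by rewrite HZ// HZ'// bounded_RintegralB// mulrBl.
Qed.

Lemma prob_fin (A : set T) : measurable A -> P A \is a fin_num.
Proof. by move=> mA; exact: fin_num_measure. Qed.

Lemma prob_cylinder_cons m s B : m \notin s -> uniq s -> (forall i, measurable (B i)) ->
  fine (P (cylinder (m :: s) B)) = fine (P (xi m @^-1` B m)) * fine (P (cylinder s B)).
Proof.
move=> ms us mB; have [ind _] := xi_iid.
have us' : uniq (m :: s) by rewrite /= ms.
rewrite /cylinder ind// ind// big_cons fineM//.
  by apply: prob_fin; rewrite -[X in measurable X]setTI; exact: measurable_funP.
rewrite -(ind s B us mB); apply: prob_fin; exact: measurable_cylinder.
Qed.

Lemma prob_Rintegral_indic_RV (X : {RV P >-> R}) (A : set R) : measurable A ->
  E (fun w => \1_A (X w)) = fine (P (X @^-1` A)).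
Proof.
move=> mA; rewrite -prob_Rintegral_indic//.
by rewrite -[X in measurable X]setTI; exact: measurable_funP.
Qed.

(** For an indicator [g] this is the hypothesis on [Z] tested on a cylinder with the index [m]
    added; [expectation_extend] carries it to bounded measurable [g]. The conclusion has the shape
    of the hypothesis, so that factors can be multiplied in one at a time. *)
Lemma indep_tail_mul m Z (g : R -> R) : indep_tail m Z ->
  measurable_fun setT g -> (exists M, forall x, `|g x| <= M) ->
  indep_tail m.+1 (fun w => Z w * g (xi m w)) /\
  E (fun w => Z w * g (xi m w)) = E Z * E (fun w => g (xi 0%N w)).
Proof.
move=> [bZ HZ] mg gM; have [_ idd] := xi_iid.
have bg : bounded_mfun (fun w => g (xi m w)) by apply: bounded_mfun_comp.
have key s B : uniq s -> (forall i, i \in s -> (m.+1 <= i)%N) ->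
    (forall i, measurable (B i)) ->
    E (fun w => Z w * \1_(cylinder s B) w * g (xi m w)) =
    E Z * fine (P (cylinder s B)) * E (fun w => g (xi 0%N w)).
  move=> us ms mB; have bI := bounded_mfun_indic (measurable_cylinder s mB).
  apply: expectation_extend => //; first exact: bounded_mfunM.
  move=> A mA.
  have mns : m \notin s by apply/negP => /ms; rewrite ltnn.
  (* The set at [m] can be replaced by [A] without affecting the cylinder over [s], as [m] is not in
     [s]. *)
  pose B' i := if i == m then A else B i.
  have mB' i : measurable (B' i) by rewrite /B'; case: ifP.
  have BB' : {in s, B' =1 B}.
    by move=> i is_; rewrite /B' ifN//; apply: contraNneq mns => <-.
  have B'm : B' m = A by rewrite /B' eqxx.
  have := HZ (m :: s) B'; rewrite /= mns us => /(_ isT) H.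
  rewrite (_ : (fun w => _) = (fun w => Z w * \1_(cylinder (m :: s) B') w)); last first.
    apply: funext => w; rewrite cylinder_cons (cylinder_ext BB') B'm indicI/= -mulrA.
    by congr (_ * _); rewrite mulrC !indicE; congr (_ * _); congr (nat_of_bool _)%:R;
      apply/idP/idP => /set_mem h; apply/mem_set.
  rewrite H//; last by move=> i; rewrite inE => /orP[/eqP ->//|/ms /ltnW].
  rewrite prob_cylinder_cons// B'm (cylinder_ext BB') prob_Rintegral_indic_RV// -(idd m A mA).
  by ring.
have E0 : E (fun w => Z w * g (xi m w)) = E Z * E (fun w => g (xi 0%N w)).
  have := key [::] (fun=> setT) isT (fun i => ltac:(by [])) (fun=> measurableT).
  have -> : cylinder [::] (fun=> setT) = setT.
    by apply/seteqP; split => // w _ i.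
  rewrite probability_setT mulr1 indicT => <-.
  by congr Rintegral; apply: funext => w; rewrite mulr1.
split => //; split; first exact: bounded_mfunM.
move=> s B us ms mB; rewrite E0 mulrAC -key//.
by congr Rintegral; apply: funext => w; rewrite mulrAC.
Qed.

Definition charfun_re (u : R) := E (fun w => cos (u * xi 0%N w)).
Definition charfun_im (u : R) := E (fun w => sin (u * xi 0%N w)).

Lemma measurable_scale (u : R) : measurable_fun setT (fun x : R => u * x).
Proof. by apply: measurable_funM => //; exact: measurable_cst. Qed.

Let mcos (u : R) : measurable_fun setT (fun x : R => cos (u * x)).
Proof.
apply: (@measurableT_comp _ _ _ _ _ _ (@cos R)); last exact: measurable_scale.
by apply: continuous_measurable_fun; exact: continuous_cos.
Qed.

Let msin (u : R) : measurable_fun setT (fun x : R => sin (u * x)).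
Proof.
apply: (@measurableT_comp _ _ _ _ _ _ (@sin R)); last exact: measurable_scale.
by apply: continuous_measurable_fun; exact: continuous_sin.
Qed.

Let bcos (u : R) : exists M : R, forall x, `|cos (u * x)| <= M.
Proof. by exists 1 => x; exact: cos_max. Qed.

Let bsin (u : R) : exists M : R, forall x, `|sin (u * x)| <= M.
Proof. by exists 1 => x; exact: sin_max. Qed.

Definition lincomb (u : nat -> R) m w : R := \sum_(1 <= i < m) u i * xi i w.

(** Multiplicativity of the squared modulus of the characteristic function, in real form. Cosine and
    sine are carried together because the addition formulas mix them, and tail independence is part
    of the induction so that [indep_tail_mul] applies to the next variable. *)
Lemma charfun_prod (u : nat -> R) m : (0 < m)%N ->
  [/\ indep_tail m (fun w => cos (lincomb u m w)),
      indep_tail m (fun w => sin (lincomb u m w)) &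
  E (fun w => cos (lincomb u m w)) ^+ 2 + E (fun w => sin (lincomb u m w)) ^+ 2
   = \prod_(1 <= i < m) (charfun_re (u i) ^+ 2 + charfun_im (u i) ^+ 2)].
Proof.
elim: m => [//|[_ _|m IH _]].
  have -> : (fun w => cos (lincomb u 1 w)) = fun=> 1.
    by apply: funext => w; rewrite /lincomb big_geq// cos0.
  have -> : (fun w => sin (lincomb u 1 w)) = fun=> 0.
    by apply: funext => w; rewrite /lincomb big_geq// sin0.
  split; [exact: indep_tail_cst|exact: indep_tail_cst|].
  by rewrite !prob_Rintegral_cst big_geq// expr0n/= addr0 expr1n.
have [iC iS EP] := IH isT.
have [i1 e1] := indep_tail_mul iC (mcos (u m.+1)) (bcos (u m.+1)).
have [i2 e2] := indep_tail_mul iC (msin (u m.+1)) (bsin (u m.+1)).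
have [i3 e3] := indep_tail_mul iS (mcos (u m.+1)) (bcos (u m.+1)).
have [i4 e4] := indep_tail_mul iS (msin (u m.+1)) (bsin (u m.+1)).
have lS w : lincomb u m.+2 w = lincomb u m.+1 w + u m.+1 * xi m.+1 w.
  by rewrite /lincomb big_nat_recr.
have -> : (fun w => cos (lincomb u m.+2 w)) = (fun w =>
    cos (lincomb u m.+1 w) * cos (u m.+1 * xi m.+1 w) -
    sin (lincomb u m.+1 w) * sin (u m.+1 * xi m.+1 w)).
  by apply: funext => w; rewrite lS cosD.
have -> : (fun w => sin (lincomb u m.+2 w)) = (fun w =>
    sin (lincomb u m.+1 w) * cos (u m.+1 * xi m.+1 w) +
    cos (lincomb u m.+1 w) * sin (u m.+1 * xi m.+1 w)).
  by apply: funext => w; rewrite lS sinD.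
split; [exact: indep_tailB|exact: indep_tailD|].
rewrite bounded_RintegralB ?bounded_RintegralD ?e1 ?e2 ?e3 ?e4;
  [|by case: i3|by case: i2|by case: i1|by case: i4].
rewrite big_nat_recr//= -EP -/(charfun_re _) -/(charfun_im _); ring.
Qed.

Definition zeta w : R := xi 0%N w - xi 1%N w.

Lemma measurable_zeta : measurable_fun setT zeta.
Proof. by apply: measurable_funB; exact: measurable_funPT. Qed.

(** Symmetrisation: [|phi|^2] is the characteristic function of the difference of two independent
    copies. *)
Lemma charfun_sq (u : R) : charfun_re u ^+ 2 + charfun_im u ^+ 2 = E (fun w => cos (u * zeta w)).
Proof.
have [[b1 _] e1] := indep_tail_mul (indep_tail_cst 0 1) (mcos u) (bcos u).
have [[b2 _] e2] := indep_tail_mul (indep_tail_cst 0 1) (msin u) (bsin u).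
have [i1 _] := indep_tail_mul (indep_tail_cst 0 1) (mcos u) (bcos u).
have [i2 _] := indep_tail_mul (indep_tail_cst 0 1) (msin u) (bsin u).
have [[b3 _] e3] := indep_tail_mul i1 (mcos u) (bcos u).
have [[b4 _] e4] := indep_tail_mul i2 (msin u) (bsin u).
rewrite -/(charfun_re u) prob_Rintegral_cst mul1r in e1.
rewrite -/(charfun_im u) prob_Rintegral_cst mul1r in e2.
rewrite -/(charfun_re u) e1 in e3; rewrite -/(charfun_im u) e2 in e4.
rewrite !expr2 -e3 -e4 -bounded_RintegralD//; congr Rintegral; apply: funext => w.
by rewrite !mul1r /zeta mulrBr cosB.
Qed.

(** The expectation is the real part of the characteristic function rotated by [al], hence at most
    its modulus. Each factor of the squared modulus is [1 - E (1 - cos)], and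
    [1 - v <= exp (- v)]. *)
Lemma charfun_bound (u : nat -> R) (m : nat) (al : R) : (0 < m)%N ->
  E (fun w => cos (lincomb u m w - al)) ^+ 2 <=
  expR (- \sum_(1 <= i < m) E (fun w => 1 - cos (u i * zeta w))).
Proof.
move=> m0; have [[bC _] [bS _] EP] := charfun_prod u m0.
rewrite (_ : (fun w => cos _) = (fun w => cos al * cos (lincomb u m w) +
   sin al * sin (lincomb u m w))); last first.
  by apply: funext => w; rewrite cosB mulrC [sin _ * _]mulrC.
rewrite bounded_RintegralD ?bounded_RintegralZl//; last 2 first.
- by apply: bounded_mfunM => //; exact: bounded_mfun_cst.
- by apply: bounded_mfunM => //; exact: bounded_mfun_cst.
set c := E _ in EP *; set s := E _ in EP *.
apply: (@le_trans _ _ (c ^+ 2 + s ^+ 2)).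
  have := sqr_ge0 (cos al * s - sin al * c); have := cos2Dsin2 al.
  move: (cos al) (sin al) => x y xy h.
  have : (x * c + y * s) ^+ 2 + (x * s - y * c) ^+ 2 = (x ^+ 2 + y ^+ 2) * (c ^+ 2 + s ^+ 2) by ring.
  rewrite xy mul1r; lra.
rewrite EP -sumrN expR_sum.
have bcz i : bounded_mfun (fun w => cos (u i * zeta w)).
  apply: bounded_mfun_cos; apply: measurable_funM; [exact: measurable_cst|exact: measurable_zeta].
apply: ler_prod => i _; rewrite addr_ge0 ?sqr_ge0//= charfun_sq.
rewrite bounded_RintegralB//; last exact: bounded_mfun_cst.
by rewrite prob_Rintegral_cst opprB; apply: le_trans (expR_ge1Dx _); lra.
Qed.

(** As [1 - cos >= 0], the exponent in [charfun_bound] may be restricted to the event that [zeta]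
    lies in [[z1, z2]], where the sum is at least [k]. *)
Lemma charfun_zeta_bound (u : nat -> R) (m : nat) (al z1 z2 k : R) : (0 < m)%N -> 0 <= k ->
  (forall z, z1 <= z <= z2 -> k <= \sum_(1 <= i < m) (1 - cos (u i * z))) ->
  E (fun w => cos (lincomb u m w - al)) ^+ 2 <=
  expR (- (fine (P (zeta @^-1` `[z1, z2])) * k)).
Proof.
move=> m0 k0 H; apply: le_trans (charfun_bound u al m0) _.
rewrite ler_expR lerN2.
have bcz i : bounded_mfun (fun w => 1 - cos (u i * zeta w)).
  apply: bounded_mfunB; first exact: bounded_mfun_cst.
  apply: bounded_mfun_cos; apply: measurable_funM; [exact: measurable_cst|exact: measurable_zeta].
have mA : measurable (zeta @^-1` `[z1, z2]).
  rewrite -[X in measurable X]setTI; apply: measurable_zeta => //; exact: measurable_itv.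
rewrite -bounded_Rintegral_sum// -prob_Rintegral_indic// mulrC -bounded_RintegralZl; last exact: bounded_mfun_indic.
apply: bounded_Rintegral_le; [|exact: bounded_mfun_sum|].
  by apply: bounded_mfunM; [exact: bounded_mfun_cst|exact: bounded_mfun_indic].
move=> w; rewrite indicE; case: (boolP (_ \in _)) => [/set_mem/= h|_].
  by rewrite mulr1; apply: H; move: h; rewrite in_itv.
rewrite mulr0; apply: sumr_ge0 => i _; by rewrite subr_ge0 cos_le1.
Qed.

End Independence.

(** * Nondegeneracy of the symmetrised variable *)

Section Nondegenerate.
Context {R : realType} {d : measure_display} {T : measurableType d}.
Variable P : probability T R.

Lemma measurable_preimage_RV (X : {RV P >-> R}) (A : set R) : measurable A ->
  measurable (X @^-1` A).
Proof. by move=> mA; rewrite -[X in measurable X]setTI; exact: measurable_funP. Qed.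

Lemma ge0_integral_eq0 (f : T -> \bar R) (N : set T) :
  measurable_fun setT f -> (forall w, 0 <= f w)%E -> measurable N ->
  (forall w, ~ N w -> f w = 0)%E -> P N = 0%E -> (\int[P]_w f w = 0)%E.
Proof.
move=> mf f0 mN fN PN; rewrite (ge0_negligible_integral mN)//.
by apply: integral0_eq => w [_ /fN].
Qed.

(** If one of the two signs had probability zero, the mean being zero would make both the positive
    and the negative part integrate to zero. Then [X = 0] almost surely, contradicting variance
    one. *)
Lemma variance1_neq0 (X : {RV P >-> R}) :
  ('E_P[X] = 0)%E -> ('V_P[X] = 1)%E ->
  P (X @^-1` `]0, +oo[) <> 0%E /\ P (X @^-1` `]-oo, 0[) <> 0%E.
Proof.
move=> EX VX.
have mX : measurable_fun setT (EFin \o X) by apply/measurable_EFinP; exact: measurable_funPT.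
have mp := measurable_funepos mX; have mn := measurable_funeneg mX.
have contra : (\int[P]_w (EFin \o X)^\+ w = 0)%E -> (\int[P]_w (EFin \o X)^\- w = 0)%E -> False.
  move=> Ip In.
  have I0 : (\int[P]_w `|(EFin \o X) w| = 0)%E.
    under eq_integral => w _ do rewrite -[(`|_|)%E]/((abse \o (EFin \o X)) w) fune_abse.
    by rewrite ge0_integralD// Ip In adde0.
  have /(ae_eq_integral_abs P measurableT mX) ae0 := I0.
  move: VX; rewrite /variance unlock EX unlock => VX.
  suff : (\int[P]_w (((X \- cst (fine 0)) * (X \- cst (fine 0))) w)%:E = 0)%E.
    by rewrite VX => /eqP; rewrite onee_eq0.
  rewrite (@ae_eq_integral _ _ _ P setT (cst 0%E)) ?integral0//.
    apply/measurable_EFinP; apply: measurable_funM;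
      by apply: measurable_funB; [exact: measurable_funPT|exact: measurable_cst].
  apply: filterS ae0 => w /(_ I)/= [Xw] _.
  by rewrite /GRing.mul/= Xw !subr0 mul0r.
have IE : (\int[P]_w (EFin \o X)^\+ w - \int[P]_w (EFin \o X)^\- w = 0)%E.
  by rewrite -integralE -EX unlock.
split=> PN.
- have Ip : (\int[P]_w (EFin \o X)^\+ w = 0)%E.
    apply: (ge0_integral_eq0 _ _ _ _ PN) => //; first by apply: measurable_preimage_RV; exact: measurable_itv.
    move=> w /=; rewrite in_itv/= andbT => /negP; rewrite -leNgt => Xw.
    by rewrite funeposE/= -EFin_max max_r.
  apply: contra => //.
  by move: IE; rewrite Ip add0e => /eqP; rewrite oppe_eq0 => /eqP.
- have In : (\int[P]_w (EFin \o X)^\- w = 0)%E.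
    apply: (ge0_integral_eq0 _ _ _ _ PN) => //; first by apply: measurable_preimage_RV; exact: measurable_itv.
    move=> w /=; rewrite in_itv/= => /negP; rewrite -leNgt => Xw.
    by rewrite funenegE/= -EFin_max max_r// oppr_le0.
  apply: contra => //.
  by move: IE; rewrite In sube0.
Qed.

Lemma prob_itv_exhaust (X : {RV P >-> R}) (F : nat -> set R) (A : set R) :
  measurable A -> (forall k, measurable (F k)) -> A `<=` \bigcup_k F k ->
  P (X @^-1` A) <> 0%E -> exists k, (0 < P (X @^-1` F k))%E.
Proof.
move=> mA mF AF PA; apply: contrapT => /forallNP H; apply: PA.
apply/negligibleP; first exact: measurable_preimage_RV.
apply: (@negligibleS _ _ _ _ (\bigcup_k (X @^-1` F k))).
  by move=> w /AF.
apply: negligible_bigcup => k; apply/negligibleP; first exact: measurable_preimage_RV.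
apply/eqP; rewrite eq_le measure_ge0 andbT leNgt; exact/negP/H.
Qed.

Lemma itv_exhaust_pos : (`]0, +oo[%classic : set R) `<=`
  \bigcup_k `[k.+1%:R^-1, k.+1%:R]%classic.
Proof.
move=> x /=; rewrite in_itv/= andbT => x0.
pose k := maxn (Num.truncn x) (Num.truncn x^-1).
exists k => //=; rewrite in_itv/=.
have xi0 : 0 <= x^-1 by rewrite invr_ge0 ltW.
have /andP[_ h1] := truncn_itv (ltW x0).
have /andP[_ h2] := truncn_itv xi0.
apply/andP; split.
  rewrite -[leRHS]invrK lef_pV2 ?posrE ?invr_gt0 ?ltr0n//.
  by apply/ltW/(lt_le_trans h2); rewrite ler_nat ltnS leq_maxr.
by apply/ltW/(lt_le_trans h1); rewrite ler_nat ltnS leq_maxl.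
Qed.

(** By independence, with positive probability [xi 0] lies in a compact interval of positive numbers
    while [xi 1] lies in one of negative numbers; their difference is then bounded and bounded away
    from zero. *)
Lemma zeta_spread (xi : nat -> {RV P >-> R}) : iid xi ->
  ('E_P[xi 0%N] = 0)%E -> ('V_P[xi 0%N] = 1)%E ->
  exists z1 z2 : R, [/\ 0 < z1, z1 <= z2 & 0 < fine (P (zeta xi @^-1` `[z1, z2]))].
Proof.
move=> Hiid EX VX; have [Pp Pn] := variance1_neq0 EX VX.
have [k kP] := prob_itv_exhaust (measurable_itv _) (fun k => measurable_itv _) itv_exhaust_pos Pp.
have exn : (`]-oo, 0[%classic : set R) `<=` \bigcup_k `[- k.+1%:R, - k.+1%:R^-1]%classic.
  move=> x /=; rewrite in_itv/= => x0.
  have /itv_exhaust_pos [l _] : (`]0, +oo[%classic : set R) (- x).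
    by rewrite /= in_itv/= andbT oppr_gt0.
  by rewrite /= in_itv/= => /andP[h1 h2]; exists l => //=; rewrite in_itv/= lerNl h2 lerNr h1.
have [l lP] := prob_itv_exhaust (measurable_itv _) (fun k => measurable_itv _) exn Pn.
pose A : set R := `[k.+1%:R^-1, k.+1%:R]%classic.
pose B : set R := `[- l.+1%:R, - l.+1%:R^-1]%classic.
have mA : measurable A by exact: measurable_itv.
have mB : measurable B by exact: measurable_itv.
exists (k.+1%:R^-1 + l.+1%:R^-1), (k.+1%:R + l.+1%:R).
have inv1 (m : nat) : m.+1%:R^-1 <= m.+1%:R :> R.
  by rewrite (@le_trans _ _ 1)// ?invf_le1 ?ler1n.
split; [by rewrite addr_gt0 ?invr_gt0|exact: lerD|].
pose D i : set R := if i == 0%N then A else B.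
have mD i : measurable (D i) by rewrite /D; case: ifP.
have mC := measurable_cylinder xi [:: 0%N; 1%N] mD.
have mZ : measurable (zeta xi @^-1` `[k.+1%:R^-1 + l.+1%:R^-1, k.+1%:R + l.+1%:R]).
  by rewrite -[X in measurable X]setTI; apply: measurable_zeta => //; exact: measurable_itv.
apply: (@lt_le_trans _ _ (fine (P (cylinder xi [:: 0%N; 1%N] D)))).
  rewrite !prob_cylinder_cons//.
  have -> : cylinder xi [::] D = setT by apply/seteqP; split => // w _ i.
  rewrite probability_setT mulr1 /D/=; have [_ idd] := Hiid.
  rewrite (idd 1%N B mB) mulr_gt0// fine_gt0//.
    by rewrite kP ltey_eq fin_num_measure//; exact: measurable_preimage_RV.
  by rewrite lP ltey_eq fin_num_measure//; exact: measurable_preimage_RV.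
rewrite fine_le ?fin_num_measure// le_measure ?inE// => w.
rewrite !cylinder_cons /D/= => -[h0 [h1 _]].
move: h0 h1; rewrite /A /B /= !in_itv/= /zeta => /andP[a1 a2] /andP[b1 b2].
by apply/andP; split; apply: lerD => //; [rewrite lerNr | rewrite lerNl].
Qed.

End Nondegenerate.

(** * The small ball estimate *)

Section Kernel.
Context {R : realType}.

(** With truncated subtraction the exponent is the distance [|k - c|]. Multiplied by [1 - r], the
    partial sums telescope, separately up to [c] and beyond it. *)
Lemma sum_geometric_dist (r : R) (c M : nat) : 0 < r < 1 ->
  \sum_(k < M) r ^+ ((k - c) + (c - k)) <= 2 / (1 - r).
Proof.
case/andP=> r0 r1; have r1' : 0 < 1 - r by lra.
have below m : (m <= c)%N ->
    (\sum_(k < m) r ^+ ((k - c) + (c - k))) * (1 - r) <= r ^+ (c - m).+1.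
  elim: m => [|m IH] mc; first by rewrite big_ord0 mul0r exprn_ge0// ltW.
  rewrite big_ord_recr/= mulrDl.
  have -> : (m - c = 0)%N by apply/eqP; rewrite subn_eq0 ltnW.
  rewrite add0n; have := IH (ltnW mc).
  have -> : (c - m = (c - m.+1).+1)%N by rewrite subnSK.
  by rewrite !exprS; move: (r ^+ _) (\sum_(_ < _) _) => u S *; lra.
have above e : (\sum_(k < c + e) r ^+ ((k - c) + (c - k))) * (1 - r) <= 2 - r ^+ e.
  elim: e => [|e IH]; first by rewrite addn0 expr0 (le_trans (below c _))// subnn expr1; lra.
  rewrite addnS big_ord_recr/= mulrDl.
  have -> : (c + e - c + (c - (c + e)) = e)%N by rewrite addKn subnDA subnn sub0n addn0.
  by rewrite exprS; move: IH; move: (r ^+ _) (\sum_(_ < _) _) => u S *; lra.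
rewrite ler_pdivlMr//.
have p e : 0 <= r ^+ e by rewrite exprn_ge0// ltW.
have [Mc|cM] := leqP M c.
  apply: le_trans (below M Mc) _; apply: (@le_trans _ _ 1); last lra.
  by apply: exprn_ile1; exact: ltW.
rewrite -(subnKC (ltnW cM)); apply: le_trans (above _) _.
by rewrite gerBl.
Qed.

(** Both sides are [|\sum_k exp (i al_k)|^2]. *)
Lemma sum_cos_diff (I : finType) (al : I -> R) :
  \sum_k \sum_l cos (al k - al l) =
  (\sum_k cos (al k)) ^+ 2 + (\sum_k sin (al k)) ^+ 2.
Proof.
rewrite !expr2 !big_distrlr/= -big_split/=; apply: eq_bigr => k _.
by rewrite -big_split/=; apply: eq_bigr => l _; rewrite cosB.
Qed.

(** All phases [k1 U + k2 V] are at most [2 M del <= 1] in size, so each cosine is at least [1/2]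
    and the real part of the exponential sum is at least [M^2 / 2]. *)
Lemma box_kernel (M : nat) (U V del : R) : (0 < M)%N -> 2 * M%:R * del <= 1 ->
  `|U| < del -> `|V| < del ->
  1 <= 4 / M%:R ^+ 4 * \sum_(k : 'I_M * 'I_M) \sum_(l : 'I_M * 'I_M)
    cos ((k.1%:R - l.1%:R) * U + (k.2%:R - l.2%:R) * V).
Proof.
move=> M0 Md Ud Vd.
pose al (k : 'I_M * 'I_M) : R := k.1%:R * U + k.2%:R * V.
rewrite (_ : \sum_k _ = \sum_k \sum_l cos (al k - al l)); last first.
  by apply: eq_bigr => k _; apply: eq_bigr => l _; congr cos; rewrite /al; ring.
rewrite sum_cos_diff.
have Mp : 0 < M%:R :> R by rewrite ltr0n.
have d0 : 0 <= del by apply: le_trans (ltW Ud).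
have h k : 2^-1 <= cos (al k).
  apply: cos_ge_half; rewrite /al (le_trans (ler_normD _ _))//.
  have e (i : 'I_M) W : `|W| < del -> `|i%:R * W| <= M%:R * del.
    move=> Wd; rewrite normrM normr_nat; apply: ler_pM => //; last exact: ltW.
    by rewrite ler_nat ltnW.
  have := e k.1 U Ud; have := e k.2 V Vd; lra.
have h2 : M%:R ^+ 2 / 2 <= \sum_k cos (al k).
  have : \sum_(k : 'I_M * 'I_M) 2^-1 <= \sum_k cos (al k) by exact: ler_sum.
  by rewrite sumr_const card_prod card_ord -[X in X <= _]mulr_natl natrM expr2.
rewrite mulrAC ler_pdivlMr ?exprn_gt0// mul1r.
have h3 : (M%:R ^+ 2 / 2) ^+ 2 <= (\sum_k cos (al k)) ^+ 2.
  have ? : 0 <= M%:R ^+ 2 / 2 :> R by rewrite divr_ge0// sqr_ge0.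
  by rewrite lerXn2r ?nnegrE//; exact: le_trans h2.
have -> : M%:R ^+ 4 = 4 * (M%:R ^+ 2 / 2) ^+ 2 :> R by field.
have := sqr_ge0 (\sum_k sin (al k)); lra.
Qed.

Lemma expR_min_le (p a b : R) : 0 <= p ->
  expR (- (p * Num.min a b)) <= expR (- (p * a)) + expR (- (p * b)).
Proof.
move=> p0; have [ab|ab] := leP a b.
  by rewrite lerDl expR_ge0.
by rewrite lerDr expR_ge0.
Qed.

Lemma dist_natE (k l : nat) : `|k%:R - l%:R| = ((k - l) + (l - k))%:R :> R.
Proof.
have [kl|lk] := leqP k l.
  have -> : (k - l = 0)%N by apply/eqP; rewrite subn_eq0.
  by rewrite add0n natrB// distrC ger0_norm// subr_ge0 ler_nat.
have -> : (l - k = 0)%N by apply/eqP; rewrite subn_eq0 ltnW.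
by rewrite addn0 natrB 1?ltnW// ger0_norm// subr_ge0 ler_nat ltnW.
Qed.

(** Since [n <= n^2] for integers, the Gaussian is dominated by a geometric weight in the [l^1]
    distance, which factors over the coordinates. For fixed [k] the sum over [l] is bounded
    independently of [M], and there are [M^2] choices of [k]. *)
Lemma kernel_gaussian_sum (M : nat) (q z e : R) : 0 < q -> 0 < z -> 0 <= e -> 
  \sum_(k : 'I_M * 'I_M) \sum_(l : 'I_M * 'I_M)
    (expR (- (q * (z * (`|k.1%:R - l.1%:R| + `|k.2%:R - l.2%:R|)) ^+ 2)) + e) <=
  (M%:R * (2 / (1 - expR (- (q * z ^+ 2))))) ^+ 2 + M%:R ^+ 4 * e.
Proof.
move=> q0 z0 e0; set r := expR (- (q * z ^+ 2)).
have r01 : 0 < r < 1.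
  by rewrite expR_gt0 expR_lt1 oppr_lt0 mulr_gt0// exprn_gt0.
pose D (a b : 'I_M) := ((a - b) + (b - a))%N.
have tm (k l : 'I_M * 'I_M) :
    expR (- (q * (z * (`|k.1%:R - l.1%:R| + `|k.2%:R - l.2%:R|)) ^+ 2)) <=
    r ^+ D k.1 l.1 * r ^+ D k.2 l.2.
  rewrite !dist_natE -natrD -exprD /r -expRM_natr ler_expR mulNr lerN2 exprMn [leRHS]mulrA.
  have qz : 0 <= q * z ^+ 2 by rewrite mulr_ge0 ?sqr_ge0// ltW.
  apply: ler_wpM2l => //.
  by rewrite -natrX ler_nat -/(D k.1 l.1) -/(D k.2 l.2); case: (_ + _)%N => // n; rewrite expnS leq_pmulr// expn1.
under eq_bigr => k _ do rewrite big_split/=.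
rewrite big_split/= lerD//; last first.
  rewrite !sumr_const card_prod card_ord -mulrnA -[leLHS]mulr_natl !natrM.
  by rewrite le_eqVlt; apply/orP; left; apply/eqP; ring.
apply: (@le_trans _ _ (\sum_(k : 'I_M * 'I_M) \sum_(l : 'I_M * 'I_M)
    r ^+ D k.1 l.1 * r ^+ D k.2 l.2)).
  by apply: ler_sum => k _; apply: ler_sum => l _.
have inner (k : 'I_M * 'I_M) : \sum_(l : 'I_M * 'I_M) r ^+ D k.1 l.1 * r ^+ D k.2 l.2
    <= (2 / (1 - r)) ^+ 2.
  rewrite (_ : \sum_l _ = (\sum_(a < M) r ^+ D k.1 a) * (\sum_(b < M) r ^+ D k.2 b)); last first.
    by rewrite big_distrlr/= pair_big.
  have g (c : 'I_M) : 0 <= \sum_(a < M) r ^+ D c a <= 2 / (1 - r).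
    rewrite sumr_ge0; last by move=> a _; rewrite exprn_ge0// expR_ge0.
    apply: le_trans (sum_geometric_dist c M r01).
    by apply: ler_sum => a _; rewrite /D addnC.
  have /andP[g1 g2] := g k.1; have /andP[g3 g4] := g k.2.
  by rewrite expr2 ler_pM.
apply: le_trans (ler_sum _ (fun k _ => inner k)) _.
rewrite sumr_const card_prod card_ord -[leLHS]mulr_natl natrM [leRHS]exprMn.
by rewrite [M%:R ^+ 2]expr2.
Qed.

End Kernel.

(** * From the ball probability to characteristic functions *)

Section SmallBall.
Context {R : realType} {d : measure_display} {T : measurableType d}.
Variable P : probability T R.
Variable xi : nat -> {RV P >-> R}.
Implicit Types (N x del : R) (n M : nat) (a : R * R).

Definition phase x (t1 t2 : R) i : R :=
  qpois x i * (t1 + t2 * ((i%:R - x ^+ 2) / x)).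

Lemma phaseZ x z t1 t2 i : phase x (z * t1) (z * t2) i = phase x t1 t2 i * z.
Proof. by rewrite /phase; ring. Qed.

Lemma Sn_lincomb N n x a t1 t2 w : 0 < N ->
  t1 * ((Sn xi N n x w).1 / Num.sqrt N - a.1) +
  t2 * ((Sn xi N n x w).2 / Num.sqrt N - a.2) =
  lincomb xi (phase x t1 t2) n.+1 w - (t1 * a.1 + t2 * a.2).
Proof.
move=> N0; have s0 : Num.sqrt N != 0 by rewrite gt_eqF// sqrtr_gt0.
have -> : (Sn xi N n x w).1 / Num.sqrt N = \sum_(1 <= i < n.+1) xi i w * qpois x i.
  rewrite /Sn/= mulr_suml; apply: eq_bigr => i _; rewrite /bcoef /qpois.
  rewrite -mulrA; congr (_ * _).
  transitivity (Num.sqrt N / Num.sqrt N *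
    (expR (- x ^+ 2 / 2) * x ^+ i / Num.sqrt i`!%:R)); first by ring.
  by rewrite divff// mul1r.
have -> : (Sn xi N n x w).2 / Num.sqrt N =
    \sum_(1 <= i < n.+1) xi i w * (qpois x i * ((i%:R - x ^+ 2) / x)).
  rewrite /Sn/= mulr_suml; apply: eq_bigr => i _; rewrite /ccoef /qpois.
  rewrite -mulrA; congr (_ * _).
  transitivity (Num.sqrt N / Num.sqrt N * (expR (- x ^+ 2 / 2) * x ^+ i /
    Num.sqrt i`!%:R * ((i%:R - x ^+ 2) / x))); first by ring.
  by rewrite divff// mul1r.
rewrite !mulrBr !mulr_sumr opprD addrACA -big_split/=; congr (_ + _).
by rewrite /lincomb; apply: eq_bigr => i _; rewrite /phase; ring.
Qed.

Lemma measurable_lincomb (u : nat -> R) n : measurable_fun setT (lincomb xi u n).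
Proof.
rewrite /lincomb; elim: n => [|n IH].
  by under eq_fun do rewrite big_geq//; exact: measurable_cst.
have [->|n0] := posnP n; first by under eq_fun do rewrite big_geq//; exact: measurable_cst.
under eq_fun do rewrite big_nat_recr//=.
apply: measurable_funD => //; apply: measurable_funM; [exact: measurable_cst|exact: measurable_funPT].
Qed.

Lemma measurable_ball_event N n x a del : 0 < N ->
  measurable [set w | (((Sn xi N n x w).1 / Num.sqrt N,
                        (Sn xi N n x w).2 / Num.sqrt N) \in ball2 a del)].
Proof.
move=> N0.
pose U w := (Sn xi N n x w).1 / Num.sqrt N - a.1.
pose V w := (Sn xi N n x w).2 / Num.sqrt N - a.2.
have UE : U = fun w => lincomb xi (phase x 1 0) n.+1 w - a.1.
  apply: funext => w; have := @Sn_lincomb N n x a 1 0 w N0.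
  by rewrite !mul1r !mul0r !addr0.
have VE : V = fun w => lincomb xi (phase x 0 1) n.+1 w - a.2.
  apply: funext => w; have := @Sn_lincomb N n x a 0 1 w N0.
  by rewrite !mul1r !mul0r !add0r.
have mU : measurable_fun setT U.
  by rewrite UE; apply: measurable_funB; [exact: measurable_lincomb|exact: measurable_cst].
have mV : measurable_fun setT V.
  by rewrite VE; apply: measurable_funB; [exact: measurable_lincomb|exact: measurable_cst].
rewrite (_ : [set w | _] = (fun w => U w * U w + V w * V w) @^-1` `]-oo, del ^+ 2[); last first.
  by apply/seteqP; split => w /=; rewrite inE in_itv/= -!expr2.
rewrite -[X in measurable X]setTI.
by apply: measurable_funD => //; exact: measurable_funM.
Qed.

(** The kernel dominates the indicator of the event pointwise: on the ball, which lies in a square,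
    by [box_kernel], and elsewhere because it is a squared modulus. Taking expectations gives the
    bound. *)
Lemma prob_ball_le N n x a del M : 0 < N -> 0 < del -> (0 < M)%N -> 2 * M%:R * del <= 1 ->
  fine (P [set w | (((Sn xi N n x w).1 / Num.sqrt N,
                   (Sn xi N n x w).2 / Num.sqrt N) \in ball2 a del)]) <=
  4 / M%:R ^+ 4 * \sum_(k : 'I_M * 'I_M) \sum_(l : 'I_M * 'I_M)
    Rintegral P setT (fun w => cos (lincomb xi
       (phase x (k.1%:R - l.1%:R) (k.2%:R - l.2%:R)) n.+1 w -
       ((k.1%:R - l.1%:R) * a.1 + (k.2%:R - l.2%:R) * a.2))).
Proof.
move=> N0 d0 M0 Md.
have mA := @measurable_ball_event N n x a del N0; set A := [set w | _] in mA *.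
pose U w := (Sn xi N n x w).1 / Num.sqrt N - a.1.
pose V w := (Sn xi N n x w).2 / Num.sqrt N - a.2.
have AE w : A w <-> U w ^+ 2 + V w ^+ 2 < del ^+ 2.
  by rewrite /A /= inE.
have bc (k l : 'I_M * 'I_M) : bounded_mfun (fun w => cos (lincomb xi
       (phase x (k.1%:R - l.1%:R) (k.2%:R - l.2%:R)) n.+1 w -
       ((k.1%:R - l.1%:R) * a.1 + (k.2%:R - l.2%:R) * a.2))).
  apply: bounded_mfun_cos; apply: measurable_funB; [exact: measurable_lincomb|exact: measurable_cst].
under eq_bigr => k _ do rewrite -bounded_Rintegral_sum//.
rewrite -bounded_Rintegral_sum; last by move=> k; exact: bounded_mfun_sum.
rewrite -bounded_RintegralZl; last by apply: bounded_mfun_sum => k; exact: bounded_mfun_sum.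
rewrite -prob_Rintegral_indic//; apply: bounded_Rintegral_le.
- exact: bounded_mfun_indic.
- by apply: bounded_mfunM; [exact: bounded_mfun_cst|apply: bounded_mfun_sum => k; exact: bounded_mfun_sum].
move=> w; have -> : \sum_(k : 'I_M * 'I_M) \sum_(l : 'I_M * 'I_M) cos (lincomb xi
       (phase x (k.1%:R - l.1%:R) (k.2%:R - l.2%:R)) n.+1 w -
       ((k.1%:R - l.1%:R) * a.1 + (k.2%:R - l.2%:R) * a.2)) =
   \sum_(k : 'I_M * 'I_M) \sum_(l : 'I_M * 'I_M)
    cos ((k.1%:R - l.1%:R) * U w + (k.2%:R - l.2%:R) * V w).
  by apply: eq_bigr => k _; apply: eq_bigr => l _; rewrite -(@Sn_lincomb N).
rewrite indicE; case: (boolP (_ \in _)) => [/set_mem/AE h|_].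
  have sq (s : R) : s ^+ 2 < del ^+ 2 -> `|s| < del.
    by rewrite -[s ^+ 2]real_normK ?num_real// ltr_pXn2r ?nnegrE ?(ltW d0).
  apply: (box_kernel M0 Md); apply: sq.
    by apply: le_lt_trans h; rewrite lerDl sqr_ge0.
  by apply: le_lt_trans h; rewrite lerDr sqr_ge0.
rewrite (_ : \sum_k _ = \sum_(k : 'I_M * 'I_M) \sum_(l : 'I_M * 'I_M)
    cos ((k.1%:R * U w + k.2%:R * V w) - (l.1%:R * U w + l.2%:R * V w))); last first.
  by apply: eq_bigr => k _; apply: eq_bigr => l _; congr cos; ring.
rewrite (sum_cos_diff (fun k : 'I_M * 'I_M => k.1%:R * U w + k.2%:R * V w)).
by rewrite mulr_ge0 ?divr_ge0 ?exprn_ge0// addr_ge0 ?sqr_ge0.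
Qed.

End SmallBall.

(** Keep only the term of degree [2 (j + 1)] in the series of [exp (c N)], and use
    [N^C <= N^(j+1)]. *)
Lemma expR_powR_bound {R : realType} (c : R) (j : nat) (C : R) : 0 < c -> C <= j.+1%:R ->
  forall N : R, 1 <= N ->
  expR (- (c * N)) <= (2 * j.+1)`!%:R / c ^+ (2 * j.+1) * (N `^ (- C)) ^+ 2.
Proof.
move=> c0 Cj N N1; have N0 : 0 < N by lra.
rewrite powRN exprVn expRN.
have h1 : N `^ C <= N ^+ j.+1 by rewrite -powR_mulrn ?(ltW N0)// ler_powR.
have p0 : 0 < N `^ C by exact: powR_gt0.
have h2 : (N `^ C) ^+ 2 <= N ^+ (2 * j.+1).
  by rewrite mulnC exprM lerXn2r ?nnegrE ?exprn_ge0 ?(ltW N0) ?(ltW p0).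
have h3 : (c * N) ^+ (2 * j.+1) / (2 * j.+1)`!%:R <= expR (c * N).
  have cN : 0 <= c * N by rewrite mulr_ge0 ?(ltW c0) ?(ltW N0).
  rewrite mul2n doubleS; apply: le_trans (expR_ge1Dxn (j.*2).+1 cN); rewrite lerDr//.
have F0 : 0 < (2 * j.+1)`!%:R :> R by rewrite ltr0n fact_gt0.
rewrite -[X in _ <= X / _]invrK -invfM lef_pV2 ?posrE ?expR_gt0//; last first.
  by rewrite mulr_gt0 ?invr_gt0 ?divr_gt0 ?exprn_gt0.
apply: le_trans h3; rewrite invf_div mulrAC exprMn ler_wpM2r ?invr_ge0 ?(ltW F0)//.
by rewrite ler_wpM2l// exprn_ge0// ltW.
Qed.

(** * Choice of the box size and the final bound *)

Unset Implicit Arguments.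

Theorem theorem4p2 (R : realType) (C epsg a1 a2 : R)
  (d : measure_display) (T : measurableType d) (P : probability T R)
  (xi : nat -> {RV P >-> R}) :
  0 < C -> 0 < epsg -> epsg < 1 / 2 -> 0 < a1 -> a1 < a2 ->
  iid xi -> subgaussian (xi 0%N) ->
  ('E_P[xi 0%N] = 0)%E -> ('V_P[xi 0%N] = 1)%E ->
  exists K N0 : R, 0 < K /\
    forall (N : R) (n : nat) (x : R) (a : R * R),
      N0 <= N -> N <= Num.sqrt n%:R ->
      a1 * N <= x -> x <= a2 * N -> x <= Num.sqrt n%:R - N `^ epsg ->
      let delta := N `^ (- C) in
      (P [set w | (((Sn xi N n x w).1 / Num.sqrt N,
                   (Sn xi N n x w).2 / Num.sqrt N) \in ball2 a delta)%R]
        <= (K * delta ^+ 2)%:E)%E.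
Proof.
move=> C0 _ _ a10 _ xi_iid _ EX VX.
have [z1 [z2 [z10 z12 p0]]] := zeta_spread xi_iid EX VX.
set p := fine _ in p0.
pose j := Num.truncn C.
(* This order admits frequencies up to [c x^(j+2)], one power more than the [N^(j+1)] needed, so
   that the constants are absorbed for large [N]. *)
have [c [x0 [[c0 x01] HS]]] := @phase_sum_lower R j.+1.
pose q := p * c / 2.
have q0 : 0 < q by rewrite divr_gt0// mulr_gt0.
pose r := expR (- (q * z1 ^+ 2)).
have Cj : C <= j.+1%:R by have /andP[_ /ltW] := truncn_itv (ltW C0).
pose K1 := (2 * j.+1)`!%:R / (q * a1) ^+ (2 * j.+1).
pose K0 := 64 * (2 / (1 - r)) ^+ 2.
have K10 : 0 <= K1 by rewrite divr_ge0// exprn_ge0// mulr_ge0// ltW.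
have K00 : 0 <= K0 by rewrite mulr_ge0 ?sqr_ge0.
have z20 : 0 < z2 by exact: lt_le_trans z12.
exists (K0 + 4 * K1 + 1).
(* The thresholds ensure, in order, [N >= 1], then [x >= x0], then [N^C >= 4] so that the box size
   [M] is positive, and finally that frequencies scaled by up to [z2] stay below [c x^(j+2)]. *)
exists (Num.max 1 (Num.max (x0 / a1) (Num.max (4 `^ C^-1) (z2 / (c * a1 ^+ j.+2))))).
split; first lra.
move=> N n x a; rewrite !ge_max => /and4P[N1 Nx0 NC Nz] _ a1x _ xn; cbv zeta.
have N0 : 0 < N by lra.
set del := N `^ (- C).
have del0 : 0 < del by exact: powR_gt0.
have x0x : x0 <= x by apply: le_trans a1x; rewrite mulrC -ler_pdivrMr.
have xp : 0 < x by lra.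
have x2n : x ^+ 2 <= n%:R.
  have xs : x <= Num.sqrt n%:R by apply: le_trans xn _; rewrite gerBl powR_ge0.
  by rewrite -[leRHS]sqr_sqrtr// lerXn2r ?nnegrE ?sqrtr_ge0 ?(ltW xp).
have NCC : 4 <= N `^ C.
  rewrite -[4](_ : (4 `^ C^-1) `^ C = 4); last first.
    by rewrite -powRrM mulVf ?powRr1// gt_eqF.
  by apply: ge0_ler_powR; rewrite ?nnegrE ?powR_ge0 ?(ltW C0) ?(ltW N0)//.
have delE : del = (N `^ C)^-1 by rewrite /del powRN.
have NC0 : 0 < N `^ C by lra.
(* The largest [M] with [2 M del <= 1]; it is still at least [N^C / 4]. *)
pose M := Num.truncn (N `^ C / 2).
have /andP[M1 M2] : M%:R <= N `^ C / 2 < M.+1%:R by apply: truncn_itv; lra.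
rewrite -[M.+1%:R]natr1 in M2.
have M4 : N `^ C / 4 <= M%:R by lra.
have Mp : 0 < M%:R :> R by lra.
have M0 : (0 < M)%N by rewrite -(ltr_nat R).
have Md : 2 * M%:R * del <= 1 by rewrite delE ler_pdivrMr//; lra.
pose F (t1 t2 : R) : R := expR (- (q * (z1 * (`|t1| + `|t2|)) ^+ 2)) + expR (- (q * x)).
have HF t1 t2 al : `|t1| + `|t2| <= 2 * M%:R ->
    Rintegral P setT (fun w => cos (lincomb xi (phase x t1 t2) n.+1 w - al)) <= F t1 t2.
  move=> tM; set La := `|t1| + `|t2| in tM.
  have La0 : 0 <= La by rewrite addr_ge0.
  pose k := c * Num.min ((z1 * La) ^+ 2) x.
  have k0 : 0 <= k by rewrite mulr_ge0 ?(ltW c0)// le_min sqr_ge0 ltW.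
  have hz z : z1 <= z <= z2 -> k <= \sum_(1 <= i < n.+1) (1 - cos (phase x t1 t2 i * z)).
    move=> /andP[zl zu]; have zp : 0 < z by exact: lt_le_trans zl.
    have := HS x (z * t1) (z * t2) n x0x x2n.
    rewrite !normrM (gtr0_norm zp) -mulrDr -/La => H.
    apply: le_trans (le_trans (H _) _).
    - rewrite ler_wpM2l ?(ltW c0)// le_min !ge_min lexx orbT andbT.
      by rewrite lerXn2r ?nnegrE ?mulr_ge0 ?(ltW z10) ?(ltW zp)// ler_wpM2r.
    - apply: (@le_trans _ _ (z2 * N `^ C)).
        by apply: ler_pM => //; [exact: ltW|lra].
      apply: (@le_trans _ _ (z2 * N ^+ j.+1)).
        by rewrite ler_wpM2l ?(ltW z20)// -powR_mulrn ?(ltW N0)// ler_powR.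
      apply: (@le_trans _ _ (c * (a1 * N) ^+ j.+2)); last first.
        by rewrite ler_wpM2l ?(ltW c0)// lerXn2r ?nnegrE ?mulr_ge0 ?(ltW a10) ?(ltW N0) ?(ltW xp).
      rewrite [leRHS](_ : _ = (c * a1 ^+ j.+2 * N) * N ^+ j.+1); last first.
        by rewrite exprMn [N ^+ j.+2]exprS; move: (a1 ^+ _) (N ^+ _) => u v; ring.
      rewrite ler_wpM2r ?exprn_ge0 ?(ltW N0)//.
      have aj0 : 0 < c * a1 ^+ j.+2 by apply: mulr_gt0 => //; exact: exprn_gt0.
      move: Nz; rewrite ler_pdivrMr//.
      by move=> Nz; rewrite [leRHS]mulrC.
    - by apply: ler_sum => i _; rewrite -/(phase x (z * t1) (z * t2) i) phaseZ.
  have := charfun_zeta_bound xi_iid al (ltn0Sn n) k0 hz; rewrite -/p.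
  set I := Rintegral _ _ _ => HI.
  (* Taking the square root halves the exponent, which explains the [1/2] in [q]; a nonpositive [I]
     is below any exponential. *)
  have : I <= expR (- (q * Num.min ((z1 * La) ^+ 2) x)).
    have [I0|/ltW I0] := leP I 0; first by apply: le_trans I0 (expR_ge0 _).
    rewrite -(@ler_pXn2r _ 2)// ?nnegrE ?expR_ge0//; apply: le_trans HI _.
    by rewrite -expRM_natr ler_expR /k /q; lra.
  by move=> h; apply: le_trans h (expR_min_le _ _ (ltW q0)).
rewrite -[X in (X <= _)%E]fineK; last first.
  apply: fin_num_measure; exact: measurable_ball_event.
rewrite lee_fin.
apply: le_trans (prob_ball_le xi n x a N0 del0 M0 Md) _.
have e0 : 0 <= expR (- (q * x)) by exact: expR_ge0.
have := kernel_gaussian_sum M q0 z10 e0; rewrite -/r => HK.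
apply: (@le_trans _ _ (4 / M%:R ^+ 4 *
  ((M%:R * (2 / (1 - r))) ^+ 2 + M%:R ^+ 4 * expR (- (q * x))))).
  rewrite ler_wpM2l ?divr_ge0 ?exprn_ge0//; apply: le_trans HK.
  apply: ler_sum => k _; apply: ler_sum => l _; apply: HF.
  have e (u v : 'I_M) : `|u%:R - v%:R| <= M%:R :> R.
    rewrite ler_norml; have := ltn_ord u; have := ltn_ord v.
    rewrite -!(ltr_nat R); have := ler0n R u; have := ler0n R v.
    by move: (nat_of_ord u) (nat_of_ord v) => u' v' p1 p2 p3 p4; clear - p1 p2 p3 p4; apply/andP; split; lra.
  by have := e k.1 l.1; have := e k.2 l.2; lra.
have hx : expR (- (q * x)) <= K1 * del ^+ 2.
  apply: le_trans (expR_powR_bound (mulr_gt0 q0 a10) Cj N1).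
  by rewrite ler_expR lerN2 -mulrA ler_wpM2l// ltW.
have hM : M%:R ^- 2 <= 16 * del ^+ 2.
  rewrite delE exprVn [leRHS](_ : _ = ((N `^ C / 4) ^+ 2)^-1); last by field; rewrite gt_eqF.
  by rewrite lef_pV2 ?posrE ?exprn_gt0 ?divr_gt0// lerXn2r ?nnegrE ?divr_ge0 ?(ltW NC0) ?(ltW Mp)//.
(* The near-diagonal frequencies contribute order [M^-2], hence [del^2]; the remaining term is
   exponentially small in [x >= a1 N]. *)
have -> : 4 / M%:R ^+ 4 * ((M%:R * (2 / (1 - r))) ^+ 2 + M%:R ^+ 4 * expR (- (q * x))) =
   4 * (2 / (1 - r)) ^+ 2 * M%:R ^- 2 + 4 * expR (- (q * x)).
  by move: (2 / (1 - r)) (expR _) => u v; field; rewrite gt_eqF.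
have : 4 * (2 / (1 - r)) ^+ 2 * M%:R ^- 2 <= K0 * del ^+ 2.
  have -> : K0 * del ^+ 2 = 4 * (2 / (1 - r)) ^+ 2 * (16 * del ^+ 2) by rewrite /K0; ring.
  by rewrite ler_wpM2l// mulr_ge0// sqr_ge0.
have := sqr_ge0 del; lra.
Qed.
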